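(* Let $0<p<\infty$, $d\ge1$, let $\mu$ be a finite positive Borel measure on $\overline{B}_d$, and let $l$ be a positive integer with $pl>1$. For $w\in B_d$ put $k_w(z)=(1-\langle z,w\rangle)^{-d}$ and $K_w=k_w^l/\|k_w^l\|_{H^p}$. The following are equivalent: (i) there is $C>0$ with $\int_{\overline{B}_d}|f|^p\,d\mu\ge C\|f\|^p_{H^p}$ for all $f\in C(\overline{B}_d)\cap H^p(B_d)$; (ii) there is $C>0$ with $\int_{\overline{B}_d}|K_w|^p\,d\mu\ge C$ for all $w\in B_d$; (iii) there is $C>0$ with $\mu(Q)\ge C\sigma(Q)$ for all non-isotropic balls $Q\subset\partial B_d$.
   Context: $B_d$ is the open unit ball of $\mathbb{C}^d$, $\sigma$ the normalized surface measure on $\partial B_d$, $\langle z,w\rangle=\sum z_k\overline{w_k}$. $H^p(B_d)$ ($0<p<\infty$) is the space of holomorphic $f$ on $B_d$ with $\|f\|^p_{H^p}=\sup_{0<r<1}\int_{\partial B_d}|f(r\zeta)|^p\,d\sigma(\zeta)<\infty$. A non-isotropic ball is a set $Q(\zeta,\delta)=\{\xi\in\partial B_d:|1-\langle\zeta,\xi\rangle|\le\delta\}$, $\zeta\in\partial B_d$, $\delta>0$. *)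

(* Defs.v *)
From HB Require Import structures.
From mathcomp Require Import all_boot all_order all_algebra.
From mathcomp Require Import all_classical all_reals all_analysis.
From mathcomp Require Import complex.
Import Order.TTheory GRing.Theory Num.Theory.
Import numFieldNormedType.Exports.

Set Implicit Arguments.
Unset Strict Implicit.
Unset Printing Implicit Defensive.

Local Open Scope classical_set_scope.
Local Open Scope ring_scope.

(* The complex numbers, with the topology/normed structure of
   mathcomp-analysis (R[i]^o is R[i] seen as a normed module over itself). *)
Definition CC (R : realType) := (R[i])^o.

Definition Cd (R : realType) (d : nat) := 'rV[CC R]_d.

Section Defs.
Variables (R : realType) (d : nat).
Local Notation V := (Cd R d).

Definition cinner (z w : V) : CC R :=
  \sum_(k < d) z ord0 k * (Num.conj (w ord0 k : R[i]) : CC R).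

Definition cabs (x : CC R) : R := Normc.normc (x : R[i]).

Definition enorm (z : V) : R := Num.sqrt (complex.Re (cinner z z : R[i])).

Definition unit_ball : set V := [set z | enorm z < 1].
Definition closed_unit_ball : set V := [set z | enorm z <= 1].
Definition unit_sphere : set V := [set z | enorm z = 1].

Definition BorelCd : Type := g_sigma_algebraType (@open V).

(* holomorphic on the open unit ball: complex (Frechet) differentiable,
   derivative C-linear, at each point of B_d *)
Definition holomorphic_on_ball (f : V -> CC R) : Prop :=
  forall z, unit_ball z -> differentiable f z.

Definition unitary_mx (U : 'M[CC R]_d) : Prop :=
  U *m (map_mx (fun x : CC R => (Num.conj (x : R[i]) : CC R)) U)^T = 1%:M.

(* sigma is the normalized surface measure on the unit sphere, characterized
   (Rudin, Function theory in the unit ball, 1.4) as the unique Borel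
   probability measure carried by the sphere and invariant under U(d). *)
Definition is_normalized_surface_measure
    (sigma : {measure set BorelCd -> \bar R}) : Prop :=
  [/\ sigma setT = 1%E,
      sigma (~` unit_sphere) = 0%E &
      forall U : 'M[CC R]_d, unitary_mx U ->
        forall A : set BorelCd, measurable A ->
          sigma ((fun z : V => z *m U) @^-1` A) = sigma A].

Definition Hp_pow (sigma : {measure set BorelCd -> \bar R}) (p : R)
    (f : V -> CC R) : \bar R :=
  ereal_sup [set (\int[sigma]_(zeta in (unit_sphere : set BorelCd))
                    ((cabs (f (((r%:C)%C : CC R) *: (zeta : V)))) `^ p)%:E)%E
            | r in `]0, 1[%classic].

Definition in_Hp (sigma : {measure set BorelCd -> \bar R}) (p : R)
    (f : V -> CC R) : Prop :=
  holomorphic_on_ball f /\ (Hp_pow sigma p f < +oo)%E.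

Definition Hp_norm (sigma : {measure set BorelCd -> \bar R}) (p : R)
    (f : V -> CC R) : R :=
  (fine (Hp_pow sigma p f)) `^ p^-1.

Definition kernel_k (w : V) (z : V) : CC R := ((1 - cinner z w) ^+ d)^-1.

Definition kernel_K (sigma : {measure set BorelCd -> \bar R}) (p : R)
    (l : nat) (w : V) (z : V) : CC R :=
  (kernel_k w z) ^+ l /
    (((Hp_norm sigma p (fun u => (kernel_k w u) ^+ l))%:C)%C : CC R).

Definition nonisotropic_ball (zeta : V) (delta : R) : set V :=
  [set xi | unit_sphere xi /\ cabs (1 - cinner zeta xi) <= delta].

End Defs.

(* Main.v *)
Require Import Defs.
From HB Require Import structures.
From mathcomp Require Import all_boot all_order all_algebra.
From mathcomp Require Import all_classical all_reals all_analysis.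
From mathcomp Require Import measurable_realfun complex ring lra.
Import Order.TTheory GRing.Theory Num.Theory.
Import numFieldNormedType.Exports.

(* (i) => (ii): [K_w] itself is an admissible function of norm [1].

   (ii) => (iii): integrate (ii) at [w = r xi] over [xi] in a ball [Q] and exchange the
   integrals.  By invariance under the unitary group, the function
   [F_r z = int_Q |K_(r xi) z|^p dsigma(xi)] is bounded on the closed ball by a constant
   independent of [r]; and [F_r z -> 0] as [r -> 1] for [z] outside [Q], since
   [||k_w^l||_{H^p}] blows up as [|w| -> 1].  The blow-up is where [pl > 1] enters: the sphere is
   covered by [O(delta^-d)] balls of radius [delta], which have the same measure, so that
   this measure is at least [c delta^d].  Dominated convergence gives
   [C sigma(Q) <= C' mu(Q)].

   (iii) => (i): integrating [mu(Q(zeta, delta)) h(zeta)] over [zeta] and letting [delta -> 0]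
   gives [C int_S h dsigma <= int_S h dmu] for continuous [h >= 0].  It remains to bound
   [int_S |f(r zeta)|^p dsigma] by [int_S |f|^p dsigma].  By rotation invariance one may
   average over the [N]-th roots of unity [omega_k], and on each slice the maximum
   principle for [sum_k |f(x omega_k zeta)|^p] bounds its value at [x = r] by its maximum on the
   unit circle, where it is constant up to an error that tends to [0] with [1/N].  The maximum
   principle for such sums follows from the maximum modulus principle for products
   [prod_k g_k^(n_k)]; the latter comes from the mean value property, that is, from Goursat's
   lemma applied in logarithmic polar coordinates. *)

Set Implicit Arguments.
Unset Strict Implicit.
Unset Printing Implicit Defensive.

Local Open Scope classical_set_scope.
Local Open Scope ring_scope.

(** * Goursat's lemma for closed 1-forms on rectangles *)

(** In (iii) => (i) the obstacle is that [p] is an arbitrary positive real and [f] may vanish, so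
    that a holomorphic branch of [f^p] need not exist; products with natural exponents are
    holomorphic whatever the zeros. Holomorphy means differentiability at each point, with no
    control of the derivative, so the mean value property has to come from subdivision. Finite
    averages over roots of unity fit both tools: the maximum principle takes finite sums, and each
    rotated term has the same integral over the sphere.

    In (ii) => (iii) the modulus of [1 - <z, w>] is symmetric, so an integral over the poles [w] is
    again an integral of a kernel over the sphere. It is compared directly with the norm that
    normalizes the kernel, at the price of the factor [2^(dlp)]; of the norm itself only the
    divergence matters. At distance [delta] from the boundary the [p]-th power of the kernel is of
    order [delta^(-dlp)] on a ball of measure at least [c delta^d], whence the exponent
    [d(pl - 1)]. *)

Section Goursat.
Variable R : realType.
Notation leb := (@lebesgue_measure R).

Definition segint (f : R -> R) (a b : R) : R := \int[leb]_(x in `[a, b]) f x.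

Definition cont_on (f : R -> R) (a b : R) := {within `[a, b], continuous f}.

Lemma cont_on_integrable (f : R -> R) (a b : R) : cont_on f a b ->
  leb.-integrable `[a, b] (EFin \o f).
Proof. by move=> cf; apply: continuous_compact_integrable => //; exact: segment_compact. Qed.

Lemma cont_onP (f : R -> R) (a b : R) :
  (forall x, a <= x <= b -> {for x, continuous f}) -> cont_on f a b.
Proof.
move=> H; apply: continuous_in_subspaceT => x; rewrite inE/= in_itv/= => xab.
exact: H.
Qed.

Lemma cont_onB (f g : R -> R) (a b : R) :
  cont_on f a b -> cont_on g a b -> cont_on (fun x => f x - g x) a b.
Proof. by move=> cf cg x; apply: continuousB; [exact: cf|exact: cg]. Qed.

Lemma segint_split (f : R -> R) (a b c : R) : cont_on f a c -> a <= b <= c ->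
  segint f a c = segint f a b + segint f b c.
Proof.
move=> cf /andP[ab bc].
have := @Rintegral_itvB R f (BLeft a) (BRight c) b (cont_on_integrable cf).
rewrite !bnd_simp => /(_ ab bc) E.
apply/eqP; rewrite addrC -subr_eq; apply/eqP; rewrite /segint E.
by rewrite Rintegral_itv_obnd_cbnd//; apply: integrableS (cont_on_integrable cf) => // x/=;
  rewrite !in_itv/= => /andP[? ?]; apply/andP; split; lra.
Qed.

Lemma segint_cst (k a b : R) : a <= b -> segint (cst k) a b = k * (b - a).
Proof.
move=> ab; rewrite /segint Rintegral_cst//= lebesgue_measure_itv/= lte_fin.
case: ltP => //= ba.
by have -> : a = b by [lra]; rewrite subrr.
Qed.

Lemma segint_le (f g : R -> R) (a b : R) : cont_on f a b -> cont_on g a b ->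
  (forall x, a <= x <= b -> f x <= g x) -> segint f a b <= segint g a b.
Proof.
move=> cf cg fg; by apply: le_Rintegral => //; exact: cont_on_integrable.
Qed.

Lemma segint_near (f : R -> R) (a b k e : R) : a <= b -> cont_on f a b ->
  (forall x, a <= x <= b -> `|f x - k| <= e) ->
  `|segint f a b - k * (b - a)| <= e * (b - a).
Proof.
move=> ab cf H.
have c1 t : cont_on (cst t) a b by apply: cont_onP => x _; exact: cvg_cst.
have U : segint f a b <= (k + e) * (b - a).
  rewrite -segint_cst//; apply: segint_le => // x /H; rewrite ler_norml/= => /andP[? ?]; lra.
have L : (k - e) * (b - a) <= segint f a b.
  rewrite -segint_cst//; apply: segint_le => // x /H; rewrite ler_norml/= => /andP[? ?]; lra.
by rewrite ler_norml; apply/andP; split; nra.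
Qed.

Lemma segintB (f g : R -> R) (a b : R) : cont_on f a b -> cont_on g a b ->
  segint (fun x => f x - g x) a b = segint f a b - segint g a b.
Proof. by move=> cf cg; rewrite /segint RintegralB//; exact: cont_on_integrable. Qed.

Definition diff2 (P : R -> R -> R) (x0 y0 a b : R) :=
  forall e, 0 < e -> exists2 dl, 0 < dl & forall x y,
   `|x - x0| < dl -> `|y - y0| < dl ->
   `|P x y - P x0 y0 - a * (x - x0) - b * (y - y0)|
     <= e * (`|x - x0| + `|y - y0|).

Lemma diff2_contx P x0 y0 a b : diff2 P x0 y0 a b -> {for x0, continuous (P ^~ y0)}.
Proof.
move=> /(_ 1 ltr01)[dl dl0 H]; apply/cvgrPdist_le => /= e e0.
have K : 0 < `|a| + 1 by have := normr_ge0 a; lra.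
near=> x.
have xd : `|x - x0| < dl.
  by rewrite distrC; near: x; exact: cvgr_dist_lt.
have xe : `|x - x0| <= e / (`|a| + 1).
  by rewrite distrC; near: x; apply: cvgr_dist_le => //; exact: divr_gt0.
have := H x y0 xd; rewrite subrr normr0 => /(_ dl0); rewrite mulr0 subr0 addr0 mul1r => H1.
rewrite distrC (_ : P x y0 - P x0 y0 = (P x y0 - P x0 y0 - a * (x - x0)) + a * (x - x0)); last by ring.
apply: le_trans (ler_normD _ _) _; rewrite normrM.
by move: xe; rewrite ler_pdivlMr//; lra.
Unshelve. all: by end_near. Qed.

Lemma diff2_swap P x0 y0 a b : diff2 P x0 y0 a b -> diff2 (fun y x => P x y) y0 x0 b a.
Proof.
move=> H e /H[dl dl0 {}H]; exists dl => // x y hx hy; have := H _ _ hy hx.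
by rewrite (addrC `|x - y0|) (addrAC _ (- (b * _))).
Qed.

Lemma diff2_conty P x0 y0 a b : diff2 P x0 y0 a b -> {for y0, continuous (P x0)}.
Proof. by move/diff2_swap/diff2_contx. Qed.

Section rect.
Variables (P Q : R -> R -> R).

(** The form [P dx + Q dy] is closed at the point: the shared [b] is both the [y]-derivative of [P]
    and the [x]-derivative of [Q]. *)
Definition closed_at x y := exists a b c, diff2 P x y a b /\ diff2 Q x y b c.

(** The counterclockwise integral of [P dx + Q dy] along the boundary of the rectangle with lower
    left corner [(x, y)] and sides [s] and [t]. *)
Definition rectint x y s t : R :=
  (segint (P ^~ y) x (x + s) - segint (P ^~ (y + t)) x (x + s)) +
  (segint (Q (x + s)) y (y + t) - segint (Q x) y (y + t)).

Definition closed_rect x y s t := forall u v, x <= u <= x + s -> y <= v <= y + t ->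
  closed_at u v.

Lemma closed_rectx x y s t v : closed_rect x y s t -> y <= v <= y + t ->
  cont_on (P ^~ v) x (x + s).
Proof. by move=> H vy; apply: cont_onP => u /H/(_ vy)[a [b [c [/diff2_contx]]]]. Qed.

Lemma closed_recty x y s t u : closed_rect x y s t -> x <= u <= x + s ->
  cont_on (Q u) y (y + t).
Proof. by move=> H ux; apply: cont_onP => v /(H _ _ ux)[a [b [c [_ /diff2_conty]]]]. Qed.

Lemma rectint_split x y s t : 0 <= s -> 0 <= t -> closed_rect x y s t ->
  rectint x y s t = rectint x y (s / 2) (t / 2) + rectint (x + s / 2) y (s / 2) (t / 2)
   + rectint x (y + t / 2) (s / 2) (t / 2) + rectint (x + s / 2) (y + t / 2) (s / 2) (t / 2).
Proof.
move=> s0 t0 H; rewrite /rectint.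
have E a u : a + u / 2 + u / 2 = a + u :> R by lra.
rewrite !E.
have HP v : y <= v <= y + t -> segint (P ^~ v) x (x + s) =
    segint (P ^~ v) x (x + s / 2) + segint (P ^~ v) (x + s / 2) (x + s).
  by move=> hv; apply: segint_split; [exact: closed_rectx H hv|lra].
have HQ u : x <= u <= x + s -> segint (Q u) y (y + t) =
    segint (Q u) y (y + t / 2) + segint (Q u) (y + t / 2) (y + t).
  by move=> hv; apply: segint_split; [exact: closed_recty H hv|lra].
by rewrite !HP ?HQ; try lra.
Qed.

Lemma closed_rect_sub x y s t x' y' s' t' : closed_rect x y s t ->
  x <= x' -> x' + s' <= x + s -> y <= y' -> y' + t' <= y + t ->
  closed_rect x' y' s' t'.
Proof. by move=> H ? ? ? ? u v hu hv; apply: H; lra. Qed.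

(** The affine part of [P] contributes [- b * t * s] and that of [Q] contributes [b * s * t]. They
    cancel, and what is left are the remainders, at most [e * (s + t)] at each point of the four
    sides. *)
Lemma rectint_small x y s t u v a b c e dl : 0 <= s -> 0 <= t -> closed_rect x y s t ->
  0 <= e -> x <= u <= x + s -> y <= v <= y + t -> s < dl -> t < dl ->
  (forall x y, `|x - u| < dl -> `|y - v| < dl ->
   `|P x y - P u v - a * (x - u) - b * (y - v)|
     <= e * (`|x - u| + `|y - v|)) ->
  (forall x y, `|x - u| < dl -> `|y - v| < dl ->
   `|Q x y - Q u v - b * (x - u) - c * (y - v)|
     <= e * (`|x - u| + `|y - v|)) ->
  `|rectint x y s t| <= 2 * e * (s + t) ^+ 2.
Proof.
move=> s0 t0 H e0 hu hv sd td HP HQ.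
have Nx w : x <= w <= x + s -> `|w - u| <= s by move=> ?; rewrite ler_norml; lra.
have Ny w : y <= w <= y + t -> `|w - v| <= t by move=> ?; rewrite ler_norml; lra.
have B1 : e * (s + t) >= 0 by apply: mulr_ge0 => //; lra.
have HP' p q : x <= p <= x + s -> y <= q <= y + t ->
   `|P p q - P u v - a * (p - u) - b * (q - v)| <= e * (s + t).
  move=> hp hq; apply: le_trans (HP _ _ _ _) _; have := Nx _ hp; have := Ny _ hq; try lra.
  by move=> ? ?; apply: ler_wpM2l => //; lra.
have HQ' p q : x <= p <= x + s -> y <= q <= y + t ->
   `|Q p q - Q u v - b * (p - u) - c * (q - v)| <= e * (s + t).
  move=> hp hq; apply: le_trans (HQ _ _ _ _) _; have := Nx _ hp; have := Ny _ hq; try lra.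
  by move=> ? ?; apply: ler_wpM2l => //; lra.
have cP w : y <= w <= y + t -> cont_on (P ^~ w) x (x + s) by apply: closed_rectx.
have cQ w : x <= w <= x + s -> cont_on (Q w) y (y + t) by apply: closed_recty.
rewrite /rectint -!segintB; try (by apply: cP; lra); try (by apply: cQ; lra).
have J1 : `|segint (fun w => P w y - P w (y + t)) x (x + s) - (- b * t) * (x + s - x)|
    <= 2 * (e * (s + t)) * (x + s - x).
  apply: segint_near; [lra|by apply: cont_onB; apply: cP; lra|] => w hw.
  have yy : y <= y <= y + t by lra.
  have yt : y <= y + t <= y + t by lra.
  have := HP' w y hw yy; have := HP' w (y + t) hw yt.
  by rewrite !ler_norml; lra.
have J2 : `|segint (fun w => Q (x + s) w - Q x w) y (y + t) - (b * s) * (y + t - y)|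
    <= 2 * (e * (s + t)) * (y + t - y).
  apply: segint_near; [lra|by apply: cont_onB; apply: cQ; lra|] => w hw.
  have yy : x <= x <= x + s by lra.
  have yt : x <= x + s <= x + s by lra.
  have := HQ' x w yy hw; have := HQ' (x + s) w yt hw.
  by rewrite !ler_norml; lra.
have Ex : x + s - x = s by lra.
have Ey : y + t - y = t by lra.
rewrite Ex in J1; rewrite Ey in J2.
move: J1 J2; rewrite !ler_norml => /andP[? ?] /andP[? ?]; apply/andP; split; nra.
Qed.

Lemma rectint_quarter x y s t : 0 <= s -> 0 <= t -> closed_rect x y s t ->
  exists p : R * R, [/\ p.1 = x \/ p.1 = x + s / 2, p.2 = y \/ p.2 = y + t / 2 &
   `|rectint x y s t| <= 4 * `|rectint p.1 p.2 (s / 2) (t / 2)|].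
Proof.
move=> s0 t0 H; rewrite (rectint_split s0 t0 H); set A := rectint x y _ _.
set B := rectint _ y _ _; set C := rectint x _ _ _; set D := rectint _ _ _ _.
have N : `|A + B + C + D| <= `|A| + `|B| + `|C| + `|D|.
  apply: le_trans (ler_normD _ _) _; rewrite lerD2r.
  by apply: le_trans (ler_normD _ _) _; rewrite lerD2r; exact: ler_normD.
set S := `|A + B + C + D| in N *.
have [h|h] := leP S (4 * `|A|); first by exists (x, y); split; auto.
have [h1|h1] := leP S (4 * `|B|); first by exists (x + s / 2, y); split; auto.
have [h2|h2] := leP S (4 * `|C|); first by exists (x, y + t / 2); split; auto.
by exists (x + s / 2, y + t / 2); split; auto; rewrite -/D; lra.
Qed.

(** Keep quartering and retain a quarter that carries at least a fourth of the integral. The bound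
    of [rectint_small] shrinks by the same factor [4], so its small coefficient at the common point
    of the rectangles bounds the original integral. *)
Lemma Goursat x y s t : 0 <= s -> 0 <= t -> closed_rect x y s t -> rectint x y s t = 0.
Proof.
move=> s0 t0 H.
pose inside (p : R * R) n := [/\ x <= p.1, p.1 + s / 2 ^+ n <= x + s, y <= p.2 &
  p.2 + t / 2 ^+ n <= y + t].
have step (p : R * R) n : inside p n -> exists q : R * R, [/\ inside q n.+1,
   p.1 <= q.1 /\ q.1 + s / 2 ^+ n.+1 <= p.1 + s / 2 ^+ n,
   p.2 <= q.2 /\ q.2 + t / 2 ^+ n.+1 <= p.2 + t / 2 ^+ n &
   `|rectint p.1 p.2 (s / 2 ^+ n) (t / 2 ^+ n)| <=
    4 * `|rectint q.1 q.2 (s / 2 ^+ n.+1) (t / 2 ^+ n.+1)|].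
  move=> [i1 i2 i3 i4].
  have hs : 0 <= s / 2 ^+ n by rewrite divr_ge0// exprn_ge0.
  have ht : 0 <= t / 2 ^+ n by rewrite divr_ge0// exprn_ge0.
  have [q [q1 q2 q3]] := rectint_quarter hs ht (closed_rect_sub H i1 i2 i3 i4).
  have E a : a / 2 ^+ n.+1 = a / 2 ^+ n / 2 :> R by rewrite exprSr invfM mulrA.
  exists q; rewrite /inside !E; split => //.
  - clear -q1 q2 i1 i2 i3 i4 hs ht.
    by case: q1 => ->; case: q2 => ->; split; lra.
  - by clear -q1 hs; case: q1 => ->; lra.
  - by clear -q2 ht; case: q2 => ->; lra.
have i0 : inside (x, y) 0 by rewrite /inside expr0 !divr1/=.
(* Outside the invariant [inside] the iteration stays put; [un] shows that this default never
   occurs. *)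
pose nxt (a : (R * R) * nat) : (R * R) * nat :=
  if pselect (inside a.1 a.2) is left h then (projT1 (cid (step _ _ h)), a.2.+1) else a.
pose u n := iter n nxt ((x, y), 0%N).
have un n : (u n).2 = n /\ inside (u n).1 n.
  elim: n => [//|n [IH1 IH2]]; rewrite /u iterS -/(u n) /nxt.
  case: pselect => [h|]; last by rewrite IH1.
  by case: cid => q [] /=; rewrite IH1.
have ustep n : [/\ (u n).1.1 <= (u n.+1).1.1 /\
   (u n.+1).1.1 + s / 2 ^+ n.+1 <= (u n).1.1 + s / 2 ^+ n,
   (u n).1.2 <= (u n.+1).1.2 /\ (u n.+1).1.2 + t / 2 ^+ n.+1 <= (u n).1.2 + t / 2 ^+ n &
   `|rectint (u n).1.1 (u n).1.2 (s / 2 ^+ n) (t / 2 ^+ n)| <=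
    4 * `|rectint (u n.+1).1.1 (u n.+1).1.2 (s / 2 ^+ n.+1) (t / 2 ^+ n.+1)|].
  have [E I] := un n; rewrite /u iterS -/(u n) /nxt.
  case: pselect => [h|]; last by rewrite E.
  by case: cid => q [] /= _; rewrite E.
(* Nested intervals: left ends increase and right ends decrease, so the supremum of the left ends
   lies in all of them. *)
have mono (v : nat -> R) w : 0 <= w -> (forall n, v n <= v n.+1) ->
   (forall n, v n.+1 + w / 2 ^+ n.+1 <= v n + w / 2 ^+ n) ->
   exists l, forall n, v n <= l <= v n + w / 2 ^+ n.
  move=> w0 h1 h2.
  have m1 : {homo v : m n / (m <= n)%N >-> m <= n} by apply: homo_leq => //; exact: le_trans.
  have m2 m n : (m <= n)%N -> v n + w / 2 ^+ n <= v m + w / 2 ^+ m.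
    elim: n => [|n IH]; first by rewrite leqn0 => /eqP ->.
    by rewrite leq_eqVlt => /predU1P[->//|/IH]; apply: le_trans.
  have ub n m : v m <= v n + w / 2 ^+ n.
    have [mn|/ltnW nm] := leqP m n.
      by apply: le_trans (m1 _ _ mn) _; rewrite lerDl divr_ge0// exprn_ge0.
    by apply: le_trans (m2 _ _ nm); rewrite lerDl divr_ge0// exprn_ge0.
  exists (sup (range v)) => n; apply/andP; split.
    apply: sup_upper_bound; last by exists n.
    by split; [exists (v 0%N); exists 0%N|exists (v 0%N + w / 2 ^+ 0) => _ [m _ <-]; exact: ub].
  by apply: sup_le_ub; [exists (v 0%N); exists 0%N|move=> _ [m _ <-]; exact: ub].
have [lx hlx] : exists l, forall n, (u n).1.1 <= l <= (u n).1.1 + s / 2 ^+ n.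
  by apply: (mono (fun n => (u n).1.1)) => // n; have [[]] := ustep n.
have [ly hly] : exists l, forall n, (u n).1.2 <= l <= (u n).1.2 + t / 2 ^+ n.
  by apply: (mono (fun n => (u n).1.2)) => // n; have [_ []] := ustep n.
have big n : `|rectint x y s t| <=
    4 ^+ n * `|rectint (u n).1.1 (u n).1.2 (s / 2 ^+ n) (t / 2 ^+ n)|.
  elim: n => [|n IH]; first by rewrite !expr0 !divr1 mul1r.
  apply: le_trans IH _; rewrite exprSr -mulrA ler_wpM2l ?exprn_ge0//.
  by have [] := ustep n.
have [a [b [c [hP hQ]]]] : closed_at lx ly.
  by apply: H; have := hlx 0%N; have := hly 0%N; rewrite !expr0 !divr1.
apply/eqP; rewrite -normr_le0; apply/ler_addgt0Pr => e e0; rewrite add0r.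
(* The factor [4 ^+ n] of [big] cancels against the square of [2 ^+ n], which leaves
   [2 * e' * (s + t) ^+ 2], at most [e]. The summand [1] keeps the denominator positive for a
   degenerate rectangle. *)
pose e' := e / (2 * (s + t) ^+ 2 + 1).
have D0 : 0 < 2 * (s + t) ^+ 2 + 1 by have := sqr_ge0 (s + t); lra.
have e'0 : 0 < e' by rewrite divr_gt0.
have [d1 d10 h1] := hP _ e'0; have [d2 d20 h2] := hQ _ e'0.
have [n hn] : exists n, (s + t) / 2 ^+ n < Num.min d1 d2.
  have m0 : 0 < Num.min d1 d2 by rewrite lt_min d10.
  have := @cvg_geometric R (s + t) (2^-1).
  rewrite ger0_norm ?invr_ge0// invf_lt1// ltr1n => /(_ isT).
  move=> /cvgrPdist_lt/(_ _ m0)[n _ /(_ n (leqnn _))]/=.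
  by rewrite sub0r normrN exprVn => hh; exists n; apply: le_lt_trans (ler_norm _) hh.
have [E [i1 i2 i3 i4]] := un n.
have hs : 0 <= s / 2 ^+ n by rewrite divr_ge0// exprn_ge0.
have ht : 0 <= t / 2 ^+ n by rewrite divr_ge0// exprn_ge0.
apply: le_trans (big n) _.
have {}hn : s / 2 ^+ n < Num.min d1 d2 /\ t / 2 ^+ n < Num.min d1 d2.
  by clear -hn hs ht; move: hn; rewrite mulrDl; split; lra.
have K : `|rectint (u n).1.1 (u n).1.2 (s / 2 ^+ n) (t / 2 ^+ n)| <=
    2 * e' * (s / 2 ^+ n + t / 2 ^+ n) ^+ 2.
  apply: (@rectint_small _ _ _ _ lx ly a b c e' (Num.min d1 d2) hs ht
    (closed_rect_sub H i1 i2 i3 i4) (ltW e'0) (hlx n) (hly n) hn.1 hn.2).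
  - by move=> p q; rewrite !lt_min => /andP[? ?] /andP[? ?]; exact: h1.
  - by move=> p q; rewrite !lt_min => /andP[? ?] /andP[? ?]; exact: h2.
apply: le_trans (ler_wpM2l _ K) _; first exact: exprn_ge0.
have -> : 4 ^+ n = (2 ^+ n) ^+ 2 :> R by rewrite -exprM mulnC exprM expr2 -natrM.
set A := 2 ^+ n; have A0 : A != 0 by rewrite expf_neq0// pnatr_eq0.
have -> : A ^+ 2 * (2 * e' * (s / A + t / A) ^+ 2) = e' * (2 * (s + t) ^+ 2) by field.
rewrite /e' mulrAC ler_pdivrMr//.
by rewrite ler_pM2l// lerDl.
Qed.

End rect.
End Goursat.

(** * Complex numbers *)

Section ComplexBasics.
Variable R : realType.
Implicit Types (x y z w : CC R).

Definition Rc (r : R) : CC R := (r%:C)%C.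
Definition ReC (x : CC R) : R := complex.Re (x : R[i]).
Definition ImC (x : CC R) : R := complex.Im (x : R[i]).
Definition cj (x : CC R) : CC R := Num.conj (x : R[i]).

Lemma cjE x : cj x = Complex (ReC x) (- ImC x).
Proof. by case: x. Qed.

Lemma cabs_norm x : `|x| = Rc (cabs x) :> R[i].
Proof. by []. Qed.

Lemma cabsE x : cabs x = Num.sqrt (ReC x ^+ 2 + ImC x ^+ 2).
Proof. by case: x. Qed.

Lemma cabs_sqr x : cabs x ^+ 2 = ReC x ^+ 2 + ImC x ^+ 2.
Proof. by rewrite cabsE sqr_sqrtr// addr_ge0 ?sqr_ge0. Qed.

Lemma cabs_ge0 x : 0 <= cabs x.
Proof. by rewrite cabsE sqrtr_ge0. Qed.

Lemma cabsM x y : cabs (x * y) = cabs x * cabs y.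
Proof. exact: Normc.normcM. Qed.

Lemma cabsD x y : cabs (x + y) <= cabs x + cabs y.
Proof. exact: le_normcD. Qed.

Lemma cabsN x : cabs (- x) = cabs x.
Proof. exact: normcN. Qed.

Lemma cabsB x y : cabs (x - y) = cabs (y - x).
Proof. by rewrite -cabsN opprB. Qed.

Lemma cabs0 : cabs (0 : CC R) = 0.
Proof. exact: Normc.normc0. Qed.

Lemma cabs1 : cabs (1 : CC R) = 1.
Proof. exact: Normc.normc1. Qed.

Lemma cabsV x : cabs x^-1 = (cabs x)^-1.
Proof. exact: Normc.normcV. Qed.

Lemma cabs_eq0 x : (cabs x == 0) = (x == 0).
Proof. by apply/eqP/eqP => [/Normc.eq0_normc//|->]; exact: cabs0. Qed.

Lemma cabs_gt0 x : (0 < cabs x) = (x != 0).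
Proof. by rewrite lt_def cabs_ge0 andbT cabs_eq0. Qed.

Lemma cabsX x n : cabs (x ^+ n) = cabs x ^+ n.
Proof. by elim: n => [|n IH]; rewrite ?expr0 ?cabs1// !exprS cabsM IH. Qed.

Lemma cabs_prod (I : Type) (r : seq I) (F : I -> CC R) :
  cabs (\prod_(i <- r) F i) = \prod_(i <- r) cabs (F i).
Proof. by elim/big_rec2: _ => [|i a b _ <-]; rewrite ?cabs1// cabsM. Qed.

Lemma cabs_Rc (r : R) : cabs (Rc r) = `|r|.
Proof. by rewrite cabsE /= expr0n addr0 sqrtr_sqr. Qed.

Lemma cabs_cj x : cabs (cj x) = cabs x.
Proof. by rewrite !cabsE cjE /= sqrrN. Qed.

Lemma ReCD x y : ReC (x + y) = ReC x + ReC y. Proof. by case: x; case: y. Qed.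
Lemma ImCD x y : ImC (x + y) = ImC x + ImC y. Proof. by case: x; case: y. Qed.
Lemma ReCN x : ReC (- x) = - ReC x. Proof. by case: x. Qed.
Lemma ImCN x : ImC (- x) = - ImC x. Proof. by case: x. Qed.
Lemma ReCB x y : ReC (x - y) = ReC x - ReC y. Proof. by rewrite ReCD ReCN. Qed.
Lemma ImCB x y : ImC (x - y) = ImC x - ImC y. Proof. by rewrite ImCD ImCN. Qed.
Lemma ReCM x y : ReC (x * y) = ReC x * ReC y - ImC x * ImC y.
Proof. by case: x; case: y. Qed.
Lemma ImCM x y : ImC (x * y) = ReC x * ImC y + ImC x * ReC y.
Proof. by case: x => a b; case: y => c d /=; rewrite /ImC/= addrC (mulrC b) addrC. Qed.
Lemma ReC_Rc r : ReC (Rc r) = r. Proof. by []. Qed.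
Lemma ImC_Rc r : ImC (Rc r) = 0. Proof. by []. Qed.
Lemma ReC1 : ReC 1 = 1. Proof. by []. Qed.
Lemma ImC1 : ImC 1 = 0. Proof. by []. Qed.
Lemma ReC_cj x : ReC (cj x) = ReC x. Proof. by case: x. Qed.
Lemma ImC_cj x : ImC (cj x) = - ImC x. Proof. by case: x. Qed.

Lemma ReC_sum (I : Type) (r : seq I) (F : I -> CC R) :
  ReC (\sum_(i <- r) F i) = \sum_(i <- r) ReC (F i).
Proof. by elim/big_rec2: _ => [//|i a b _ <-]; rewrite ReCD. Qed.

Lemma ImC_sum (I : Type) (r : seq I) (F : I -> CC R) :
  ImC (\sum_(i <- r) F i) = \sum_(i <- r) ImC (F i).
Proof. by elim/big_rec2: _ => [//|i a b _ <-]; rewrite ImCD. Qed.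

Lemma Ceq x y : ReC x = ReC y -> ImC x = ImC y -> x = y.
Proof. by case: x => a b; case: y => c d /=; rewrite /ReC/ImC/= => -> ->. Qed.

Lemma cjD x y : cj (x + y) = cj x + cj y.
Proof. exact: rmorphD. Qed.
Lemma cjM x y : cj (x * y) = cj x * cj y.
Proof. exact: rmorphM. Qed.
Lemma cjK x : cj (cj x) = x.
Proof. by apply: Ceq; rewrite ?ReC_cj ?ImC_cj ?opprK. Qed.
Lemma cjN x : cj (- x) = - cj x.
Proof. exact: rmorphN. Qed.
Lemma cj0 : cj 0 = 0.
Proof. exact: rmorph0. Qed.
Lemma cj1 : cj 1 = 1.
Proof. exact: rmorph1. Qed.
Lemma cj_sum (I : Type) (r : seq I) (F : I -> CC R) :
  cj (\sum_(i <- r) F i) = \sum_(i <- r) cj (F i).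
Proof. exact: rmorph_sum. Qed.
Lemma cj_Rc r : cj (Rc r) = Rc r.
Proof. by apply: Ceq; rewrite ?ReC_cj ?ImC_cj ?ImC_Rc ?oppr0. Qed.

Lemma mulC_cj x : x * cj x = Rc (cabs x ^+ 2).
Proof. by apply: Ceq; rewrite ?ReCM ?ImCM ReC_cj ImC_cj ?ReC_Rc ?ImC_Rc ?cabs_sqr; ring. Qed.

Lemma RcD r s : Rc (r + s) = Rc r + Rc s. Proof. exact: rmorphD. Qed.
Lemma RcN r : Rc (- r) = - Rc r. Proof. exact: rmorphN. Qed.
Lemma RcM r s : Rc (r * s) = Rc r * Rc s. Proof. exact: rmorphM. Qed.
Lemma RcV r : Rc r^-1 = (Rc r)^-1. Proof. exact: fmorphV. Qed.
Lemma Rc1 : Rc 1 = 1. Proof. by []. Qed.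
Lemma normReC x : `|ReC x| <= cabs x.
Proof. by rewrite -sqrtr_sqr cabsE ler_sqrt ?addr_ge0 ?sqr_ge0// lerDl sqr_ge0. Qed.
Lemma normImC x : `|ImC x| <= cabs x.
Proof. by rewrite -sqrtr_sqr cabsE ler_sqrt ?addr_ge0 ?sqr_ge0// lerDr sqr_ge0. Qed.

Lemma cabs_le_ReIm x : cabs x <= `|ReC x| + `|ImC x|.
Proof.
rewrite -(@ler_pXn2r _ 2)// ?nnegrE ?cabs_ge0 ?addr_ge0// cabs_sqr sqrrD.
rewrite !real_normK ?num_real//.
have : 0 <= `|ReC x| * `|ImC x| by rewrite mulr_ge0.
lra.
Qed.

Lemma cabs_dist x y : `|cabs x - cabs y| <= cabs (x - y).
Proof.
have := cabsD (x - y) y; have := cabsD (y - x) x; rewrite !subrK (cabsB y x) => ? ?.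
by rewrite ler_norml; lra.
Qed.

(** The norm of [CC R] takes values in [R[i]]. A positive element there is real, so convergence can
    be expressed by [cabs] with real radii. *)
Lemma cvg_cabsP (T : Type) (F : set_system T) (FF : Filter F) (f : T -> CC R) (l : CC R) :
  f @ F --> l <-> forall e : R, 0 < e -> \forall t \near F, cabs (l - f t) < e.
Proof.
split=> [/cvgrPdist_lt H e e0|H].
  have : 0 < Rc e :> R[i] by rewrite ltcR.
  by move/H; apply: filterS => t; rewrite cabs_norm ltcR.
apply/cvgrPdist_lt => e e0; have E : e = Rc (ReC e).
  by apply: Ceq => //; rewrite ImC_Rc; apply: ger0_Im; exact: ltW.
have /H : 0 < ReC e by move: e0; rewrite {1}E ltcR.
by apply: filterS => t; rewrite cabs_norm E ltcR.
Qed.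

Lemma nbhs_cabsP x (A : set (CC R)) :
  nbhs x A <-> exists2 e : R, 0 < e & forall y, cabs (x - y) < e -> A y.
Proof.
split=> [|[e e0 H]].
  move=> /nbhs_ballP[e /= e0 H]; exists (ReC e).
    by move: e0; rewrite ltcE => /andP[].
  move=> y hy; apply: H; rewrite -ball_normE/= cabs_norm.
  rewrite (_ : e = Rc (ReC e)) ?ltcR//.
  by apply: Ceq => //; rewrite ImC_Rc; apply: ger0_Im; exact: ltW.
apply/nbhs_ballP; exists (Rc e) => /=; first by rewrite ltcR.
by move=> y; rewrite -ball_normE/= cabs_norm ltcR; exact: H.
Qed.

Lemma continuous_cabs : continuous (@cabs R).
Proof.
move=> x; apply/(@cvgrPdist_lt _ _ _ (nbhs x)) => /= e e0; apply/nbhs_cabsP; exists e => // y.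
by apply: le_lt_trans; exact: cabs_dist.
Qed.

Lemma continuous_ReC : continuous ReC.
Proof.
move=> x; apply/(@cvgrPdist_lt _ _ _ (nbhs x)) => /= e e0; apply/nbhs_cabsP; exists e => // y.
by apply: le_lt_trans; rewrite -ReCB; exact: normReC.
Qed.

Lemma continuous_ImC : continuous ImC.
Proof.
move=> x; apply/(@cvgrPdist_lt _ _ _ (nbhs x)) => /= e e0; apply/nbhs_cabsP; exists e => // y.
by apply: le_lt_trans; rewrite -ImCB; exact: normImC.
Qed.

Lemma compact_square : compact [set z : CC R | `|ReC z| <= 1 /\ `|ImC z| <= 1].
Proof.
pose F (p : R * R) : CC R := Complex p.1 p.2.
have cF : continuous F.
  move=> p; apply/cvg_cabsP => e e0; near=> q.
  apply: le_lt_trans (cabs_le_ReIm _) _; rewrite ReCB ImCB /= (splitr e).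
  apply: ltrD; near: q; apply: (@cvgr_dist_lt _ _ _ (nbhs p)); try exact: divr_gt0.
    exact: cvg_fst.
  exact: cvg_snd.
have -> : [set z : CC R | `|ReC z| <= 1 /\ `|ImC z| <= 1] =
    F @` (`[-1, 1]%classic `*` `[-1, 1]%classic).
  apply/seteqP; split => [z [h1 h2]|_ [[a b] [/= ha hb] <-]].
    by exists (ReC z, ImC z); [split; rewrite /= in_itv/= -ler_norml|case: z {h1 h2}].
  by move: ha hb; rewrite !in_itv/= -!ler_norml.
apply: continuous_compact; first exact: continuous_subspaceT.
by apply: compact_setX; exact: segment_compact.
Unshelve. all: by end_near. Qed.

Lemma compact_disc : compact [set z : CC R | cabs z <= 1].
Proof.
apply: subclosed_compact compact_square _.
  rewrite (_ : mkset _ = @cabs R @^-1` [set r | r <= 1])//.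
  by apply: closed_comp => [x _|]; [exact: continuous_cabs|exact: closed_le].
by move=> z /= hz; split; apply: le_trans hz; [exact: normReC|exact: normImC].
Qed.

Definition cdiff (g : CC R -> CC R) (z D : CC R) := forall e : R, 0 < e ->
  exists2 dl : R, 0 < dl & forall w, cabs (w - z) < dl ->
    cabs (g w - g z - D * (w - z)) <= e * cabs (w - z).

(** The differential is linear over [R[i]], hence multiplication by its value at [1]. *)
Lemma differentiable_cdiff (g : CC R -> CC R) z : differentiable g z ->
  exists D, cdiff g z D.
Proof.
move=> dg; exists ('d g z 1) => e e0.
have /eqaddoP/(_ (Rc e)) := diff_locally dg.
rewrite ltcR => /(_ e0)/nbhs_cabsP[dl dl0 H]; exists dl => // w wz.
have := H (w - z); rewrite sub0r cabsN => /(_ wz).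
rewrite /= !cabs_norm -RcM lecR !fctE/= subrK.
congr (cabs _ <= _); rewrite opprD addrA; congr (_ - _).
by rewrite -[X in 'd g z X]mulr1 -[X in 'd g z X]/((w - z) *: (1 : CC R)) linearZ/= mulrC.
Qed.

Lemma cdiff_cont g z D : cdiff g z D -> forall e : R, 0 < e ->
  exists2 dl : R, 0 < dl & forall w, cabs (w - z) < dl -> cabs (g w - g z) < e.
Proof.
move=> H e e0; have [dl dl0 {}H] := H _ ltr01.
have K : 0 < 1 + cabs D by have := cabs_ge0 D; lra.
exists (Num.min dl (e / (1 + cabs D))); first by rewrite lt_min dl0 divr_gt0.
move=> w; rewrite lt_min ltr_pdivlMr// => /andP[/H h1 h2].
rewrite -[g w - g z](subrK (D * (w - z))); apply: le_lt_trans (cabsD _ _) _.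
by rewrite cabsM; lra.
Qed.

(** * The unit circle and the roots of unity *)

Definition expi (t : R) : CC R := Complex (cos t) (sin t).

Lemma expiD s t : expi (s + t) = expi s * expi t.
Proof. by apply: Ceq; rewrite ?ReCM ?ImCM /ReC /ImC/= ?cosD ?sinD; ring. Qed.

Lemma expi0 : expi 0 = 1.
Proof. by rewrite /expi cos0 sin0. Qed.

Lemma cabs_expi t : cabs (expi t) = 1.
Proof. by rewrite cabsE /= cos2Dsin2 sqrtr1. Qed.

Lemma expi2pi : expi (pi *+ 2) = 1.
Proof. by rewrite /expi cos2pi sin2pi. Qed.

Lemma expi2pin n : expi (n%:R * (pi *+ 2)) = 1.
Proof.
elim: n => [|n IH]; first by rewrite mul0r expi0.
by rewrite -natr1 mulrDl mul1r expiD IH expi2pi mulr1.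
Qed.

Lemma Lip1_cos_sin (a b : R) : `|cos a - cos b| <= `|a - b| /\ `|sin a - sin b| <= `|a - b|.
Proof.
wlog ab : a b / a <= b => [H|].
  have [|/ltW] := leP a b; first exact: H.
  by move/H; rewrite (distrC (cos _)) (distrC (sin _)) (distrC b).
rewrite (distrC (cos a)) (distrC (sin a)) (distrC a).
have [c _ ->] := MVT_segment ab (fun s _ => is_derive_cos s) (continuous_subspaceT (@continuous_cos R)).
have [c' _ ->] := MVT_segment ab (fun s _ => is_derive_sin s) (continuous_subspaceT (@continuous_sin R)).
by rewrite !normrM normrN; split; rewrite ler_piMl// ?sin_max ?cos_max.
Qed.

Lemma cabs_expiB (a b : R) : cabs (expi a - expi b) <= 2 * `|a - b|.
Proof.
apply: le_trans (cabs_le_ReIm _) _; rewrite ReCB ImCB /=.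
by have [] := Lip1_cos_sin a b; rewrite /ReC/ImC/=; lra.
Qed.

Lemma expi_surj x : cabs x = 1 -> exists2 t, 0 <= t < pi *+ 2 & x = expi t.
Proof.
move=> x1; have hR : -1 <= ReC x <= 1 by rewrite -ler_norml -x1 normReC.
have hs : ImC x ^+ 2 = 1 - ReC x ^+ 2.
  by have := cabs_sqr x; rewrite x1 expr1n => ->; ring.
have pi0 := @pi_gt0 R.
have [i0|i0] := leP 0 (ImC x).
  exists (acos (ReC x)).
    rewrite acos_ge0//=; apply: le_lt_trans (acos_lepi hR) _; rewrite mulr2n; lra.
  apply: Ceq; rewrite /expi /ReC/ImC/= -/(ReC _) -/(ImC _) ?acosK//.
  by rewrite sin_acos// -hs sqrtr_sqr ger0_norm.
have hR1 : -1 <= ReC x < 1.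
  move: hR => /andP[-> h]/=; rewrite lt_neqAle h andbT; apply/eqP => E.
  by move: hs; rewrite E expr1n subrr => /eqP; rewrite expf_eq0/= lt_eqF.
exists (pi *+ 2 - acos (ReC x)).
  have := acos_gt0 hR1; have := acos_lepi hR; rewrite mulr2n; lra.
apply: Ceq; rewrite /expi /ReC/ImC/= -/(ReC _) -/(ImC _).
  by rewrite addrC cosD2pi cosN acosK.
by rewrite addrC sinD2pi sinN sin_acos// -hs sqrtr_sqr ltr0_norm// opprK.
Qed.

(* The index is shifted: [rootu (N := N)] enumerates the roots of unity of order [N.+1]. *)
Definition rootu (N : nat) (j : 'I_N.+1) : CC R := expi (j%:R * (pi *+ 2 / N.+1%:R)).

Lemma cabs_rootu N (j : 'I_N.+1) : cabs (rootu j) = 1.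
Proof. exact: cabs_expi. Qed.

(** The sum of indices is taken modulo [N.+1], and the wrap-around is a full turn. Rotation by a
    root of unity thus becomes a reindexing of sums over roots. *)
Lemma rootuD N (i j : 'I_N.+1) : rootu (i + j)%R = rootu i * rootu j.
Proof.
rewrite /rootu -expiD -mulrDl -natrD.
have -> : (i + j)%N%:R = ((i + j) %/ N.+1)%:R * N.+1%:R + ((i + j) %% N.+1)%:R :> R.
  by rewrite -natrM -natrD -divn_eq.
rewrite (mulrDl _ _ (pi *+ 2 / _)) expiD -mulrA.
have -> : N.+1%:R * (pi *+ 2 / N.+1%:R) = pi *+ 2 :> R.
  by rewrite mulrC mulfVK ?pnatr_eq0.
by rewrite expi2pin mul1r.
Qed.

(** The bound is the angular step [2 * pi / N.+1] times the crude Lipschitz constant [2] of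
    [cabs_expiB]. *)
Lemma rootu_net N x : cabs x = 1 -> exists j : 'I_N.+1,
  cabs (x - rootu j) <= 4 * pi / N.+1%:R.
Proof.
move=> /expi_surj[t /andP[t0 t2] ->]; have pi0 := @pi_gt0 R.
have n0 : 0 < N.+1%:R :> R by rewrite ltr0n.
have p20 : 0 < pi *+ 2 :> R by rewrite mulr2n; lra.
pose u := t / (pi *+ 2 / N.+1%:R).
have u0 : 0 <= u by rewrite /u !divr_ge0// ltW.
have tE : t = u * (pi *+ 2 / N.+1%:R) by rewrite /u mulfVK// lt0r_neq0// divr_gt0.
have un : u < N.+1%:R.
  by rewrite /u ltr_pdivrMr ?divr_gt0// mulrCA divff ?mulr1// lt0r_neq0.
have /andP[k1 k2] := truncn_itv u0.
have kN : (Num.truncn u < N.+1)%N by rewrite -(ltr_nat R); exact: le_lt_trans un.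
exists (Ordinal kN); rewrite /rootu.
apply: le_trans (cabs_expiB _ _) _.
rewrite [X in `|X|](_ : _ = (u - (Num.truncn u)%:R) * (pi *+ 2 / N.+1%:R)); last first.
  by rewrite mulrBl -tE.
rewrite normrM (gtr0_norm (divr_gt0 p20 n0)).
have : `|u - (Num.truncn u)%:R| <= 1 by move: k2; rewrite -natr1 ler_norml; lra.
move=> h; rewrite (_ : 4 * pi / N.+1%:R = 2 * (1 * (pi *+ 2 / N.+1%:R))); last first.
  by rewrite mulr2n mul1r !mulrA; congr (_ / _); ring.
by rewrite ler_wpM2l// ler_wpM2r// ltW// divr_gt0.
Qed.

End ComplexBasics.

(** * The maximum principle for sums of p-th powers of moduli *)

Section MaxModulus.
Variable R : realType.
Notation C := (CC R).
Implicit Types (z w : C).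

Definition rdiff (a : R -> R) (s a' : R) := forall e : R, 0 < e ->
  exists2 dl : R, 0 < dl & forall v : R, `|v - s| < dl ->
    `|a v - a s - a' * (v - s)| <= e * `|v - s|.

Lemma is_derive_rdiff (a : R -> R) (s a' : R) : is_derive s 1 a a' -> rdiff a s a'.
Proof.
move=> [da Da] e e0; have dg : differentiable a s by apply/derivable1_diffP.
have /eqaddoP/(_ e e0)/nbhs_ballP[dl /= dl0 H] := diff_locally dg.
exists dl => // w ws; have := H (w - s).
rewrite -ball_normE/= sub0r normrN => /(_ ws).
rewrite !fctE/= subrK.
congr (`|_| <= _); rewrite opprD addrA; congr (_ - _).
rewrite -[X in 'd a s X]mulr1 -[X in 'd a s X]/((w - s) *: (1 : R)) linearZ/=.
by rewrite -deriveE// Da mulrC.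
Qed.

Lemma rdiff_Lip (a : R -> R) (s a' : R) : rdiff a s a' ->
  exists2 dl : R, 0 < dl & forall v : R, `|v - s| < dl -> `|a v - a s| <= (`|a'| + 1) * `|v - s|.
Proof.
move=> /(_ 1 ltr01)[dl dl0 H]; exists dl => // w /H h.
rewrite -[a w - a s](subrK (a' * (w - s))); apply: le_trans (ler_normD _ _) _.
by rewrite normrM; lra.
Qed.

Lemma diff2_prod (a b : R -> R) (s t a' b' : R) : rdiff a s a' -> rdiff b t b' ->
  diff2 (fun u v => a u * b v) s t (a' * b t) (a s * b').
Proof.
move=> da db e e0.
pose K := `|b t| + `|a s| + (`|a'| + 1).
have K0 : 0 < K by rewrite /K; have := normr_ge0 (b t); have := normr_ge0 (a s); have := normr_ge0 a'; lra.
have eK : 0 < e / K by rewrite divr_gt0.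
have [d1 d10 h1] := da _ eK; have [d2 d20 h2] := db _ eK.
have [d3 d30 h3] := rdiff_Lip da; have [d4 d40 h4] := rdiff_Lip db.
have b'0 : 0 < `|b'| + 1 by have := normr_ge0 b'; lra.
pose d5 := e / K / (`|b'| + 1).
have d50 : 0 < d5 by rewrite divr_gt0.
exists (Num.min (Num.min d1 d2) (Num.min (Num.min d3 d4) d5)).
  by rewrite !lt_min d10 d20 d30 d40.
move=> u v; rewrite !lt_min => /andP[/andP[u1 _] /andP[/andP[u3 _] _]].
move=> /andP[/andP[_ v2] /andP[/andP[_ v4] v5]].
rewrite (_ : a u * b v - a s * b t - a' * b t * (u - s) - a s * b' * (v - t) =
   (a u - a s - a' * (u - s)) * b t + a s * (b v - b t - b' * (v - t))
   + (a u - a s) * (b v - b t)); last by ring.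
apply: le_trans (ler_normD _ _) _.
apply: le_trans (lerD (ler_normD _ _) (lexx _)) _; rewrite !normrM.
have {}h1 := h1 _ u1; have {}h2 := h2 _ v2; have {}h3 := h3 _ u3; have {}h4 := h4 _ v4.
have h5 : `|b v - b t| <= e / K.
  by apply: le_trans h4 _; move: v5; rewrite /d5 ltr_pdivlMr// mulrC => /ltW.
have -> : e = e / K * K by rewrite mulfVK// lt0r_neq0.
have c0 : 0 <= e / K by exact: ltW.
set c := e / K in h1 h2 h5 c0 *; clearbody c.
have i1 : `|a u - a s - a' * (u - s)| * `|b t| <= c * `|u - s| * `|b t| by apply: ler_wpM2r.
have i2 : `|a s| * `|b v - b t - b' * (v - t)| <= `|a s| * (c * `|v - t|) by apply: ler_wpM2l.
have i3 : `|a u - a s| * `|b v - b t| <= (`|a'| + 1) * `|u - s| * c by apply: ler_pM.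
have j1 : 0 <= c * `|v - t| * `|b t| by rewrite !mulr_ge0.
have j2 : 0 <= c * `|u - s| * `|a s| by rewrite !mulr_ge0.
have j3 : 0 <= c * `|v - t| * (`|a'| + 1) by rewrite !mulr_ge0 ?addr_ge0.
rewrite /K; nra.
Qed.

Definition cdiff2 (F : R -> R -> C) (s t : R) (b : C) := forall e : R, 0 < e ->
  exists2 dl : R, 0 < dl & forall s' t', `|s' - s| < dl -> `|t' - t| < dl ->
    cabs (F s' t' - F s t - b * Complex (s' - s) (t' - t)) <= e * (`|s' - s| + `|t' - t|).

(** The Cauchy-Riemann equations. They say that [Im F ds + Re F dt], the imaginary part of [F dw]
    with [w = s + i t], is closed. *)
Lemma cdiff2_ReIm F s t b : cdiff2 F s t b ->
  diff2 (fun s t => ReC (F s t)) s t (ReC b) (- ImC b) /\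
  diff2 (fun s t => ImC (F s t)) s t (ImC b) (ReC b).
Proof.
move=> H; split=> e /H[dl dl0 {}H]; exists dl => // s' t' /H{}H /H.
  apply: le_trans; apply: le_trans (normReC _).
  by rewrite !ReCB ReCM /ReC/ImC/= mulNr opprK opprB addrA addrAC le_eqVlt; apply/orP; left; apply/eqP; congr `|_|; ring.
apply: le_trans; apply: le_trans (normImC _).
by rewrite !ImCB ImCM /ReC/ImC/= le_eqVlt; apply/orP; left; apply/eqP; congr `|_|; ring.
Qed.

(** The map [s + i t |-> z0 + r e^(s + i t)]: it is holomorphic, and vertical segments of length
    [2 * pi] become circles around [z0], whose radius tends to [0] as [s] decreases. *)
Definition polar (z0 : C) (r s t : R) : C := z0 + Rc (r * expR s) * expi t.

Lemma cdiff2_polar z0 r s t : cdiff2 (polar z0 r) s t (Rc (r * expR s) * expi t).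
Proof.
have de : rdiff (fun s => r * expR s) s (r * expR s).
  apply: is_derive_rdiff; apply: is_derive_eq; rewrite /GRing.scale/=; ring.
have dc := is_derive_rdiff (is_derive_cos t).
have ds := is_derive_rdiff (is_derive_sin t).
have h1 := diff2_prod de dc; have h2 := diff2_prod de ds.
move=> e e0; have e2 : 0 < e / 2 by rewrite divr_gt0.
have [d1 d10 {}h1] := h1 _ e2; have [d2 d20 {}h2] := h2 _ e2.
exists (Num.min d1 d2); first by rewrite lt_min d10.
move=> s' t'; rewrite !lt_min => /andP[s1 s2] /andP[t1 t2].
apply: le_trans (cabs_le_ReIm _) _; rewrite /polar !(ReCB, ImCB, ReCD, ImCD, ReCM, ImCM).
rewrite !ReC_Rc !ImC_Rc /expi /ReC/ImC/=.
have := h1 _ _ s1 t1; have := h2 _ _ s2 t2.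
set x := (X in X <= _ -> _); set y := (X in _ -> X <= _ -> _) => hx hy.
rewrite (_ : e * _ = e / 2 * (`|s' - s| + `|t' - t|) + e / 2 * (`|s' - s| + `|t' - t|)); last by field.
apply: lerD.
  by apply: le_trans hy; rewrite /y le_eqVlt; apply/orP; left; apply/eqP; congr `|_|; ring.
by apply: le_trans hx; rewrite /x le_eqVlt; apply/orP; left; apply/eqP; congr `|_|; ring.
Qed.

Lemma cabs_Complex (a b : R) : cabs (Complex a b : C) <= `|a| + `|b|.
Proof. exact: cabs_le_ReIm. Qed.

Lemma cdiff2_comp (H : C -> C) F s t b D : cdiff2 F s t b -> cdiff H (F s t) D ->
  cdiff2 (fun s t => H (F s t)) s t (D * b).
Proof.
move=> dF dH e e0.
pose K := cabs b + 1; have K0 : 0 < K by rewrite /K; have := cabs_ge0 b; lra.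
pose L := cabs D + 1; have L0 : 0 < L by rewrite /L; have := cabs_ge0 D; lra.
have e1 : 0 < e / 2 / K by rewrite !divr_gt0.
have e2 : 0 < Num.min 1 (e / 2 / L) by rewrite lt_min ltr01 !divr_gt0.
have [d1 d10 h1] := dH _ e1; have [d2 d20 h2] := dF _ e2.
exists (Num.min d2 (d1 / K / 2)); first by rewrite lt_min d20 !divr_gt0.
move=> s' t'; rewrite !lt_min => /andP[s1 s2] /andP[t1 t2].
have {}h2 := h2 _ _ s1 t1.
set m := `|s' - s| + `|t' - t| in h2 *.
have m0 : 0 <= m by rewrite addr_ge0.
set f := F s' t' - F s t - _ in h2.
have hf1 : cabs f <= m.
  by apply: le_trans h2 _; rewrite ler_piMl// ge_min lexx.
have hf2 : cabs f <= e / 2 / L * m.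
  by apply: le_trans h2 _; rewrite ler_wpM2r// ge_min lexx orbT.
have hd : cabs (F s' t' - F s t) <= K * m.
  have -> : F s' t' - F s t = f + b * Complex (s' - s) (t' - t) by rewrite /f subrK.
  apply: le_trans (cabsD _ _) _; rewrite cabsM /K mulrDl mul1r addrC lerD//.
  by rewrite ler_wpM2l ?cabs_ge0// cabs_Complex.
have hd1 : cabs (F s' t' - F s t) < d1.
  apply: le_lt_trans hd _; rewrite mulrC -ltr_pdivlMr//.
  by rewrite /m; move: s2 t2; rewrite !ltr_pdivlMr//; nra.
have {}h1 := h1 _ hd1.
rewrite (_ : _ - _ = (H (F s' t') - H (F s t) - D * (F s' t' - F s t)) + D * f); last first.
  by rewrite /f; ring.
apply: le_trans (cabsD _ _) _; rewrite cabsM.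
have -> : e * m = e / 2 * m + e / 2 * m by field.
apply: lerD.
  have -> : e / 2 * m = e / 2 / K * (K * m) by rewrite mulrA mulfVK ?lt0r_neq0.
  by apply: le_trans h1 _; apply: ler_wpM2l => //; exact: ltW.
have -> : e / 2 * m = L * (e / 2 / L * m) by rewrite mulrA (mulrC L) mulfVK ?lt0r_neq0.
by apply: ler_pM; rewrite ?cabs_ge0// /L lerDl.
Qed.

(** If it failed, the mean of [Re H] would be at most [Re H z0 - c] over the outer circle, but at
    least [Re H z0 - c / 2] over a small one. Goursat's lemma on the rectangle whose vertical sides
    are these circles makes the two means equal. *)
Lemma mean_value_lt (H : C -> C) z0 (r c : R) : 0 < r -> 0 < c ->
  (forall z, cabs (z - z0) <= r -> exists D, cdiff H z D) ->
  exists t, ReC (H z0) - c < ReC (H (z0 + Rc r * expi t)).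
Proof.
move=> r0 c0 dH; apply: contrapT => /forallNP N.
have {}N t : ReC (H (z0 + Rc r * expi t)) <= ReC (H z0) - c by rewrite leNgt; apply/negP.
have [D0 dz0] : exists D, cdiff H z0 D by apply: dH; rewrite subrr cabs0 ltW.
have c2 : 0 < c / 2 by rewrite divr_gt0.
have [dl dl0 hdl] := cdiff_cont dz0 c2.
(* [S = r / dl] brings the inner radius [r * expR (- S)] below [dl], because [1 + S <= expR S]. *)
have [S S0 hS] : exists2 S, 0 <= S & r * expR (- S) < dl.
  exists (r / dl); first by rewrite divr_ge0// ltW.
  rewrite expRN ltr_pdivrMr ?expR_gt0//.
  apply: (@lt_le_trans _ _ (dl * (1 + r / dl))); last by rewrite ler_pM2l// expR_ge1Dx.
  by rewrite mulrDr mulr1 mulrC mulfVK ?lt0r_neq0// ltrDr.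
pose F s t := H (polar z0 r s t).
pose P s t := ImC (F s t); pose Q s t := ReC (F s t).
(* Periodicity in the angle, by which the two horizontal sides of the rectangle cancel. *)
have [T p2 PT] : exists2 T : R, 0 < T & P ^~ T = P ^~ 0.
  exists (pi *+ 2); first by rewrite mulr2n addr_gt0// pi_gt0.
  by apply/funext => s; rewrite /P /F /polar expi2pi expi0.
have cl : closed_rect P Q (- S) 0 S T.
  move=> s t /andP[_ s0] _; rewrite addNr in s0.
  have [|D hD] := dH (polar z0 r s t).
    rewrite /polar addrAC subrr add0r cabsM cabs_expi mulr1 cabs_Rc.
    rewrite ger0_norm ?mulr_ge0 ?expR_ge0 ?(ltW r0)// ler_piMr ?(ltW r0)//.
    by rewrite expR_le1.
  have [h1 h2] := cdiff2_ReIm (cdiff2_comp (cdiff2_polar z0 r s t) hD).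
  pose b := D * (Rc (r * expR s) * expi t).
  by exists (ImC b), (ReC b), (- ImC b); split; [exact: h2|exact: h1].
have n0 : - S <= 0 <= - S + S by rewrite addNr; lra.
have nS : - S <= - S <= - S + S by rewrite addNr; lra.
have c1 := closed_recty cl n0; have c3 := closed_recty cl nS; rewrite !add0r in c1 c3.
have cc k : cont_on (cst k) 0 T by apply: cont_onP => x _; exact: cvg_cst.
have i1 : segint (Q 0) 0 T <= (ReC (H z0) - c) * (T - 0).
  rewrite -segint_cst ?(ltW p2)//; apply: segint_le => // t _.
  by rewrite /Q /F /polar expR0 mulr1; exact: N.
have i2 : (ReC (H z0) - c / 2) * (T - 0) <= segint (Q (- S)) 0 T.
  rewrite -segint_cst ?(ltW p2)//; apply: segint_le => // t _.
  rewrite /Q /F /=; have /hdl : cabs (polar z0 r (- S) t - z0) < dl.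
    rewrite /polar addrAC subrr add0r cabsM cabs_expi mulr1 cabs_Rc.
    by rewrite ger0_norm ?mulr_ge0 ?expR_ge0 ?(ltW r0).
  move/(le_lt_trans (normReC _)); rewrite ReCB ltr_norml; lra.
have lt_c : (ReC (H z0) - c) * (T - 0) < (ReC (H z0) - c / 2) * (T - 0).
  by rewrite subr0 ltr_pM2r// ltrD2l ltrN2 ltr_pdivrMr// ltr_pMr// ltr1n.
apply/negP: (lt_le_trans (le_lt_trans i1 lt_c) i2); rewrite -leNgt.
have := Goursat S0 (ltW p2) cl; rewrite /rectint add0r addNr PT subrr add0r.
by move/subr0_eq => ->; exact: lexx.
Qed.

Lemma cont_sub_comp (T U W : topologicalType) (A : set T) (f : T -> U) (h : U -> W) :
  {within A, continuous f} -> continuous h -> {within A, continuous (h \o f)}.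
Proof. by move=> cf ch x; apply: (@continuous_comp (subspace A) _ _ f h x); [exact: cf|exact: ch]. Qed.

Definition disc : set C := [set z | cabs z <= 1].

Lemma max_modulus (g : C -> C) (B : R) :
  (forall z, cabs z < 1 -> differentiable g z) -> {within disc, continuous g} ->
  (forall z, cabs z = 1 -> cabs (g z) <= B) ->
  forall z, disc z -> cabs (g z) <= B.
Proof.
move=> dg cg hB z1 hz1; rewrite leNgt; apply/negP => Bz.
have B0 : 0 <= B by apply: le_trans (hB 1 (cabs1 _)); exact: cabs_ge0.
(* Half of the gap: on the unit circle [u] is at most [B ^+ 2 + e], still below its value at [z1],
   so [u] attains its maximum inside. There the [e]-term makes the mean value argument strict. *)
pose e := (cabs (g z1) ^+ 2 - B ^+ 2) / 2.
have e0 : 0 < e by rewrite divr_gt0// subr_gt0 ltr_pXn2r// nnegrE ?cabs_ge0.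
pose u z := cabs (g z) ^+ 2 + e * cabs z ^+ 2.
have cu : {within disc, continuous u}.
  have csq : continuous (fun x : C => cabs x ^+ 2 : R).
    by move=> x; apply: (@continuous_comp _ _ _ (@cabs R) (fun t : R => t ^+ 2));
      [exact: continuous_cabs|exact: exprn_continuous].
  have c1 : {within disc, continuous (fun z => cabs (g z) ^+ 2)} := cont_sub_comp cg csq.
  have c2 : {within disc, continuous (fun z : C => cabs z ^+ 2)} := continuous_subspaceT csq.
  by rewrite /u => z; apply: cvgD; [exact: c1|apply: cvgM; [exact: cvg_cst|exact: c2]].
have [z0 hz0 mz0] := compact_EVT_max (ex_intro _ z1 hz1) (compact_disc (R := R)) cu.
have u1 : u z1 <= u z0 by apply: mz0; rewrite inE.
rewrite inE in hz0.
have z01 : cabs z0 < 1.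
  rewrite lt_neqAle hz0 andbT; apply/eqP => E; move: u1; apply/negP; rewrite -ltNge.
  rewrite /u E expr1n mulr1.
  have : cabs (g z0) ^+ 2 <= B ^+ 2 by rewrite ler_pXn2r ?nnegrE ?cabs_ge0// hB.
  have : 0 <= e * cabs z1 ^+ 2 by rewrite mulr_ge0 ?sqr_ge0 ?(ltW e0).
  by rewrite /e in e0 *; lra.
pose r := (1 - cabs z0) / 2.
have r0 : 0 < r by rewrite divr_gt0// subr_gt0.
(* [u z - u z0 = 2 Re (H z - H z0) + |g z - g z0|^2 + e |z - z0|^2]. Hence at distance [r] from
   [z0], if [Re H] drops by less than [e * r ^+ 2 / 2], then [u z > u z0]. *)
pose H z := cj (g z0) * g z + Rc e * cj z0 * z.
have in1 z : cabs (z - z0) <= r -> cabs z < 1.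
  by move=> h; have := cabsD (z - z0) z0; rewrite subrK; rewrite /r in h; lra.
have dH z : cabs (z - z0) <= r -> exists D, cdiff H z D.
  move=> /in1/dg/differentiable_cdiff[D hD].
  exists (cj (g z0) * D + Rc e * cj z0) => d d0.
  have K : 0 < cabs (g z0) + 1 by have := cabs_ge0 (g z0); lra.
  have [dl dl0 h] := hD _ (divr_gt0 d0 K); exists dl => // w /h{}h.
  rewrite (_ : _ - _ = cj (g z0) * (g w - g z - D * (w - z))); last by rewrite /H; ring.
  rewrite cabsM cabs_cj.
  have : cabs (g z0) * cabs (g w - g z - D * (w - z)) <=
     (cabs (g z0) + 1) * (d / (cabs (g z0) + 1) * cabs (w - z)).
    by apply: ler_pM; rewrite ?cabs_ge0// lerDl.
  by rewrite mulrA (mulrC _ (d / _)) mulfVK// lt0r_neq0.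
have er : 0 < e * r ^+ 2 / 2 by rewrite divr_gt0// mulr_gt0// exprn_gt0.
have [t ht] := mean_value_lt r0 er dH.
set z := z0 + Rc r * expi t in ht.
have zz : cabs (z - z0) = r.
  by rewrite /z addrAC subrr add0r cabsM cabs_expi mulr1 cabs_Rc gtr0_norm.
clearbody z; have : u z <= u z0 by apply: mz0; rewrite inE; apply: ltW; apply: in1; rewrite zz.
have : 0 <= cabs (g z - g z0) ^+ 2 by rewrite sqr_ge0.
have : cabs (z - z0) ^+ 2 = r ^+ 2 by rewrite zz.
move: ht; rewrite /u !cabs_sqr /H !(ReCB, ImCB, ReCD, ImCD, ReCM, ImCM) !ReC_cj !ImC_cj !ReC_Rc !ImC_Rc.
set a := ReC (g z); set b := ImC (g z); set a0 := ReC (g z0); set b0 := ImC (g z0).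
set x := ReC z; set y := ImC z; set x0 := ReC z0; set y0 := ImC z0 => h1 h2 h3 h4.
have h5 : e * ((x - x0) ^+ 2 + (y - y0) ^+ 2) = e * r ^+ 2 by rewrite h2.
by nra.
Qed.

Lemma powR_X (a p : R) n : 0 <= a -> (a ^+ n) `^ p = (a `^ p) ^+ n.
Proof.
by move=> a0; elim: n => [|n IH]; rewrite ?expr0 ?powR1// !exprS powRM ?exprn_ge0// IH.
Qed.

Lemma powR_prod (I : Type) (r : seq I) (F : I -> R) (p : R) : (forall i, 0 <= F i) ->
  (\prod_(i <- r) F i) `^ p = \prod_(i <- r) F i `^ p.
Proof.
move=> F0; elim: r => [|i r IH]; first by rewrite !big_nil powR1.
by rewrite !big_cons powRM ?IH// prodr_ge0.
Qed.

Lemma differentiable_prodX (I : Type) (r : seq I) (g : I -> C -> C) (n : I -> nat) z :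
  (forall i, differentiable (g i) z) -> differentiable (fun w => \prod_(i <- r) g i w ^+ n i) z.
Proof.
move=> dg; elim: r => [|i r IH].
  by under eq_fun do rewrite big_nil; exact: differentiable_cst.
under eq_fun do rewrite big_cons; apply: (differentiableM (f := fun w => g i w ^+ n i)) => //.
case: (n i) => [|k]; last first.
  by rewrite (_ : (fun w => _) = g i ^+ k.+1); [exact: differentiableX|rewrite exprfctE].
by under eq_fun do rewrite expr0; exact: differentiable_cst.
Qed.

Lemma continuous_prodX (T : topologicalType) (I : Type) (r : seq I) (g : I -> T -> C) (n : I -> nat) :
  (forall i, continuous (g i)) -> continuous (fun t => \prod_(i <- r) g i t ^+ n i).
Proof.
move=> cg.
have cX i k : continuous (fun t => g i t ^+ k).
  elim: k => [|k IH] z; first by under eq_fun do rewrite expr0; exact: cvg_cst.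
  by under eq_fun do rewrite exprS; apply: cvgM; [exact: cg|exact: IH].
elim: r => [|i r IH] z.
  by under eq_fun do rewrite big_nil; exact: cvg_cst.
by under eq_fun do rewrite big_cons; apply: cvgM; [exact: cX|exact: IH].
Qed.

(* By weighted AM-GM, [sum_k |g_k|^p] at [z] is compared with the modulus of a single
   holomorphic function [prod_k g_k^(n_k)], whose exponents are proportional to
   [|g_k z|^p] up to rounding. *)
Lemma max_sum_powR (N : nat) (g : 'I_N -> C -> C) (p B : R) : 0 < p ->
  (forall k z, cabs z < 1 -> differentiable (g k) z) ->
  (forall k, {within disc, continuous (g k)}) ->
  (forall z, cabs z = 1 -> \sum_(k < N) cabs (g k z) `^ p <= B) ->
  forall z, cabs z <= 1 -> \sum_(k < N) cabs (g k z) `^ p <= B.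
Proof.
move=> p0 dg cg hB z hz.
have B0 : 0 <= B.
  by apply: le_trans (hB 1 (cabs1 _)); apply: sumr_ge0 => k _; exact: powR_ge0.
pose x k := cabs (g k z) `^ p.
have x0 k : 0 <= x k by exact: powR_ge0.
rewrite -/(\sum_(k < N) x k); set X := \sum_(k < N) x k.
rewrite leNgt; apply/negP => BX.
have X0 : 0 < X by exact: le_lt_trans BX.
(* Under [B < X] this is violated by large [n]. The exponents [m k] add up to [n] up to rounding,
   and the summand [N%:R] is the total rounding error. *)
have key n : 0 <= n%:R * B / X - n%:R + N%:R.
  pose c : R := n%:R / X.
  have c0 : 0 <= c by rewrite divr_ge0// ltW.
  pose m k := Num.truncn (c * x k).
  have m1 k : (m k)%:R <= c * x k < (m k)%:R + 1.
    by rewrite natr1; apply: truncn_itv; rewrite mulr_ge0.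
  have sx : \sum_(k < N) c * x k = n%:R by rewrite -mulr_sumr -/X /c mulfVK// lt0r_neq0.
  pose P : R := \prod_(k < N) x k ^+ m k.
  have P0 : 0 < P.
    apply: prodr_gt0 => k _; have [E|xk] := eqVneq (x k) 0.
      have := m1 k; rewrite E mulr0 => /andP[].
      by rewrite (_ : 0 = 0%:R)// ler_nat leqn0 => /eqP -> _; rewrite expr0.
    by rewrite exprn_gt0// lt0r xk x0.
  set E := _ - _ + _; pose K := P * expR E.
  have K0 : 0 <= K by rewrite mulr_ge0 ?expR_ge0 ?(ltW P0).
  pose G w := \prod_(k < N) g k w ^+ m k.
  have GE w : cabs (G w) `^ p = \prod_(k < N) (cabs (g k w) `^ p) ^+ m k.
    rewrite /G cabs_prod powR_prod => [|k]; last exact: cabs_ge0.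
    by apply: eq_bigr => k _; rewrite cabsX powR_X// cabs_ge0.
  have bd w : cabs w = 1 -> cabs (G w) <= K `^ p^-1.
    move=> w1; suff : cabs (G w) `^ p <= K.
      move=> h; rewrite -[leLHS](powRr1 (cabs_ge0 _)) -(mulfV (lt0r_neq0 p0)) powRrM.
      by apply: ge0_ler_powR; rewrite ?nnegrE ?powR_ge0// invr_ge0 ltW.
    pose y k := cabs (g k w) `^ p.
    have y0 k : 0 <= y k by exact: powR_ge0.
    have yB : \sum_(k < N) y k <= B by exact: hB.
    rewrite GE -/(\prod_(k < N) y k ^+ m k).
    (* From [1 + u <= expR u] at [u = y k / x k - 1], raised to the power [m k]. Where [x k = 0] the
       exponent [m k] is [0] and both sides are [1]. *)
    have st k : y k ^+ m k <= x k ^+ m k * expR ((m k)%:R * (y k / x k - 1)).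
      have [Ek|xk] := eqVneq (x k) 0.
        have := m1 k; rewrite Ek mulr0 => /andP[].
        by rewrite (_ : 0 = 0%:R)// ler_nat leqn0 => /eqP -> _; rewrite !expr0 mul0r expR0 mulr1.
      rewrite expRM_natl -exprMn lerXn2r ?nnegrE ?mulr_ge0 ?expR_ge0//.
      rewrite mulrC -ler_pdivrMr ?lt0r ?xk ?x0//.
      by apply: le_trans (expR_ge1Dx _); lra.
    apply: (@le_trans _ _ (\prod_(k < N) (x k ^+ m k * expR ((m k)%:R * (y k / x k - 1))))).
      by apply: ler_prod => k _; rewrite exprn_ge0//= st.
    rewrite big_split/= -/P -expR_sum /K ler_pM2l// ler_expR.
    apply: (@le_trans _ _ (\sum_(k < N) (c * y k - c * x k + 1))).
      apply: ler_sum => k _; have /andP[m2 m3] := m1 k.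
      have [Ek|xk] := eqVneq (x k) 0.
        move: m2; rewrite Ek mulr0 (_ : 0 = 0%:R)// ler_nat leqn0 => /eqP ->.
        by rewrite mul0r subr0 addr_ge0// mulr_ge0.
      rewrite mulrBr mulr1.
      have : (m k)%:R * (y k / x k) <= c * y k.
        rewrite mulrCA [leRHS]mulrC ler_wpM2l//.
        by rewrite ler_pdivrMr ?lt0r ?xk ?x0.
      lra.
    rewrite big_split/= sumrB -!mulr_sumr.
    rewrite sumr_const card_ord -/X.
    have -> : c * X = n%:R by rewrite -sx -mulr_sumr.
    rewrite /E lerD2r lerD2r /c mulrAC ler_pM2r ?invr_gt0//.
    by rewrite ler_wpM2l.
  have dG w : cabs w < 1 -> differentiable G w.
    by move=> w1; apply: differentiable_prodX => k; exact: dg.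
  have cG : {within disc, continuous G} by apply: continuous_prodX.
  have h := max_modulus dG cG bd hz.
  have : cabs (G z) `^ p <= K.
    rewrite -[leRHS](powRr1 K0) -(mulVf (lt0r_neq0 p0)) powRrM.
    by apply: ge0_ler_powR; rewrite ?nnegrE ?powR_ge0 ?cabs_ge0// ltW.
  rewrite GE -/(\prod_(k < N) x k ^+ m k) -/P /K -[X in X <= _]mulr1 ler_pM2l//.
  by rewrite -[X in X <= expR _]expR0 ler_expR.
(* The value of [n] at which the bound of [key] vanishes; the next integer gives the
   contradiction. *)
pose q := N%:R * X / (X - B).
have q0 : 0 <= q by rewrite divr_ge0 ?mulr_ge0 ?subr_ge0 ?(ltW X0) ?(ltW BX).
have := key (Num.truncn q).+1; have /andP[_] := truncn_itv q0.
set n := (Num.truncn q).+1%:R.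
rewrite /q ltr_pdivrMr ?subr_gt0// => h1.
rewrite -(ler_pM2r X0) mul0r mulrDl mulrBl mulfVK ?lt0r_neq0//.
by rewrite mulrBr in h1; lra.
Qed.

End MaxModulus.

(** * Geometry of the sphere *)

Section Sphere.
Variables (R : realType) (d : nat).
Notation C := (CC R).
Notation V := (Cd R d).
Implicit Types (z w a b : V).

Lemma cinnerE z w : cinner z w = \sum_(k < d) z ord0 k * cj (w ord0 k).
Proof. by []. Qed.

Lemma cinnerDl z z' w : cinner (z + z') w = cinner z w + cinner z' w.
Proof. by rewrite !cinnerE -big_split; apply: eq_bigr => k _; rewrite mxE mulrDl. Qed.

Lemma cinnerZl (c : C) z w : cinner (c *: z) w = c * cinner z w.
Proof. by rewrite !cinnerE mulr_sumr; apply: eq_bigr => k _; rewrite mxE mulrA. Qed.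

Lemma cinnerC z w : cinner w z = cj (cinner z w).
Proof. by rewrite !cinnerE cj_sum; apply: eq_bigr => k _; rewrite cjM cjK mulrC. Qed.

Lemma cinnerNl z w : cinner (- z) w = - cinner z w.
Proof. by rewrite -scaleN1r cinnerZl mulN1r. Qed.

Lemma cinnerDr z w w' : cinner z (w + w') = cinner z w + cinner z w'.
Proof. by rewrite cinnerC cinnerDl cjD -!cinnerC. Qed.

Lemma cinnerZr (c : C) z w : cinner z (c *: w) = cj c * cinner z w.
Proof. by rewrite cinnerC cinnerZl cjM -cinnerC. Qed.

Lemma cinnerNr z w : cinner z (- w) = - cinner z w.
Proof. by rewrite cinnerC cinnerNl cjN -cinnerC. Qed.

Lemma cinner0l w : cinner 0 w = 0.
Proof. by rewrite cinnerE big1// => k _; rewrite mxE mul0r. Qed.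

Lemma enorm_ge0 z : 0 <= enorm z.
Proof. exact: sqrtr_ge0. Qed.

Lemma enorm_sqr z : enorm z ^+ 2 = \sum_(k < d) cabs (z ord0 k) ^+ 2.
Proof.
have E : ReC (cinner z z) = \sum_(k < d) cabs (z ord0 k) ^+ 2.
  by rewrite cinnerE ReC_sum; apply: eq_bigr => k _; rewrite mulC_cj ReC_Rc.
by rewrite /enorm -/(ReC _) sqr_sqrtr E// sumr_ge0// => k _; rewrite sqr_ge0.
Qed.

Lemma cinnerzz z : cinner z z = Rc (enorm z ^+ 2).
Proof.
rewrite enorm_sqr cinnerE [RHS](rmorph_sum _); apply: eq_bigr => k _.
exact: mulC_cj.
Qed.

Lemma enorm_eq0 z : enorm z = 0 -> z = 0.
Proof.
move=> z0; have : enorm z ^+ 2 = 0 by rewrite z0 expr0n.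
rewrite enorm_sqr => /eqP; rewrite psumr_eq0 => [/allP h|k _]; last exact: sqr_ge0.
apply/rowP => k; rewrite mxE; apply/eqP; rewrite -cabs_eq0 -sqrf_eq0.
by apply: h; rewrite mem_index_enum.
Qed.

Lemma enormZ (c : C) z : enorm (c *: z) = cabs c * enorm z.
Proof.
apply/eqP; rewrite -(@eqrXn2 _ 2)// ?mulr_ge0 ?cabs_ge0 ?enorm_ge0//; apply/eqP.
rewrite exprMn !enorm_sqr mulr_sumr; apply: eq_bigr => k _.
by rewrite mxE cabsM exprMn.
Qed.

Lemma enormN z : enorm (- z) = enorm z.
Proof. by rewrite -scaleN1r enormZ cabsN cabs1 mul1r. Qed.

Lemma enormBC z w : enorm (z - w) = enorm (w - z).
Proof. by rewrite -enormN opprB. Qed.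

Lemma enormB_sqr z w :
  enorm (z - w) ^+ 2 = enorm z ^+ 2 + enorm w ^+ 2 - 2 * ReC (cinner z w).
Proof.
have := cinnerzz (z - w).
rewrite cinnerDl !cinnerDr !cinnerNl !cinnerNr !cinnerzz (cinnerC z w) => /(congr1 (@ReC R)).
rewrite !ReCD !ReCN ReC_cj !ReC_Rc => <-; ring.
Qed.

Lemma cauchy_schwarz z w : cabs (cinner z w) <= enorm z * enorm w.
Proof.
have [w0|w0] := eqVneq (enorm w) 0.
  by rewrite (enorm_eq0 w0) cinnerC cinner0l cabs_cj cabs0 mulr_ge0// enorm_ge0.
have wp : 0 < enorm w ^+ 2 by rewrite exprn_gt0// lt_def w0 enorm_ge0.
rewrite -(@ler_pXn2r _ 2)// ?nnegrE ?cabs_ge0 ?mulr_ge0 ?enorm_ge0//.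
have := sqr_ge0 (enorm (Rc (enorm w ^+ 2) *: z - cinner z w *: w)).
rewrite enormB_sqr !enormZ cabs_Rc (ger0_norm (ltW wp)) cinnerZl cinnerZr.
rewrite ReCM ReC_Rc ImC_Rc mul0r subr0 (mulrC (cj _)) mulC_cj ReC_Rc !exprMn => h.
rewrite -subr_ge0 -(pmulr_rge0 _ wp); apply: le_trans h _.
by rewrite le_eqVlt; apply/orP; left; apply/eqP; ring.
Qed.

Lemma enormD z w : enorm (z + w) <= enorm z + enorm w.
Proof.
rewrite -(@ler_pXn2r _ 2)// ?nnegrE ?addr_ge0 ?enorm_ge0//.
have := enormB_sqr z (- w); rewrite opprK enormN cinnerNr ReCN => ->.
have := le_trans (ler_norm _) (le_trans (normReC _) (cauchy_schwarz z w)); nra.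
Qed.

Lemma enormD_le z w : enorm z <= enorm (z - w) + enorm w.
Proof. by rewrite -{1}(subrK w z) enormD. Qed.

Lemma cabs_coord z k : cabs (z ord0 k) <= enorm z.
Proof.
rewrite -(@ler_pXn2r _ 2)// ?nnegrE ?cabs_ge0 ?enorm_ge0// enorm_sqr (bigD1 k)//= lerDl.
by rewrite sumr_ge0// => i _; rewrite sqr_ge0.
Qed.

Lemma enorm_le_coord z (e : R) : 0 <= e -> (forall k, cabs (z ord0 k) <= e) ->
  enorm z <= d%:R * e.
Proof.
move=> e0 H; rewrite -(@ler_pXn2r _ 2)// ?nnegrE ?mulr_ge0 ?enorm_ge0// enorm_sqr.
apply: (@le_trans _ _ (\sum_(k < d) e ^+ 2)).
  by apply: ler_sum => k _; rewrite ler_pXn2r ?nnegrE ?cabs_ge0.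
rewrite sumr_const card_ord -[X in X <= _]mulr_natl exprMn ler_wpM2r ?sqr_ge0// -natrX ler_nat.
by case: (d) => // n; rewrite leq_pmulr.
Qed.

(** It places a non-isotropic ball of radius [delta] in the Euclidean ball of radius
    [sqrt (2 delta)], and also serves as a lower bound for the kernel denominators. *)
Lemma enormB_sphere z w : enorm z <= 1 -> enorm w = 1 ->
  enorm (z - w) ^+ 2 <= 2 * cabs (1 - cinner z w).
Proof.
move=> z1 w1; rewrite enormB_sqr w1 expr1n.
have : enorm z ^+ 2 <= 1 by rewrite -[leRHS](expr1n _ 2) ler_pXn2r ?nnegrE ?enorm_ge0.
by have := le_trans (ler_norm _) (normReC (1 - cinner z w)); rewrite ReCB ReC1; lra.
Qed.

Lemma kernel_den_ge z w (r : R) : enorm z <= 1 -> enorm w <= r -> 1 - r <= cabs (1 - cinner z w).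
Proof.
move=> z1 wr; have h : cabs (cinner z w) <= r.
  apply: le_trans (cauchy_schwarz _ _) _; apply: le_trans wr.
  by rewrite ler_piMl ?enorm_ge0.
by have := cabsD (1 - cinner z w) (cinner z w); rewrite subrK cabs1; lra.
Qed.

Definition conj_mx m n (A : 'M[C]_(m, n)) : 'M[C]_(m, n) := map_mx (@cj R) A.

Lemma conj_mxM m n p (A : 'M[C]_(m, n)) (B : 'M[C]_(n, p)) :
  conj_mx (A *m B) = conj_mx A *m conj_mx B.
Proof. exact: (@map_mxM _ _ (Num.conj : {rmorphism R[i] -> R[i]})). Qed.

Lemma cinner_mx z w : cinner z w = (z *m (conj_mx w)^T) ord0 ord0.
Proof. by rewrite mxE cinnerE; apply: eq_bigr => k _; rewrite !mxE. Qed.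

Lemma unitaryM (U W : 'M[C]_d) : unitary_mx U -> unitary_mx W -> unitary_mx (U *m W).
Proof.
rewrite /unitary_mx -!/(conj_mx _) => hU hW.
by rewrite conj_mxM trmx_mul mulmxA -(mulmxA U) hW mulmx1.
Qed.

Lemma cinnerU (U : 'M[C]_d) z w : unitary_mx U -> cinner (z *m U) (w *m U) = cinner z w.
Proof.
rewrite /unitary_mx -/(conj_mx _) => hU.
by rewrite !cinner_mx conj_mxM trmx_mul mulmxA -(mulmxA z) hU mulmx1.
Qed.

Lemma enormU (U : 'M[C]_d) z : unitary_mx U -> enorm (z *m U) = enorm z.
Proof. by move=> hU; rewrite /enorm cinnerU. Qed.

Lemma unitary_scalar (c : C) : cabs c = 1 -> unitary_mx (c%:M : 'M[C]_d).
Proof.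
move=> c1; rewrite /unitary_mx -/(conj_mx _).
have -> : conj_mx (c%:M : 'M[C]_d) = (cj c)%:M.
  by apply/matrixP => i j; rewrite !mxE; case: eqP => _; rewrite ?mulr1n// mulr0n cj0.
by rewrite tr_scalar_mx -scalar_mxM mulC_cj c1 expr1n.
Qed.

Definition householder (v : V) : 'M[C]_d :=
  1%:M - Rc (2 / enorm v ^+ 2) *: ((conj_mx v)^T *m v).

Lemma householder_unitary v : v != 0 -> unitary_mx (householder v).
Proof.
move=> v0; have n0 : enorm v ^+ 2 != 0.
  by rewrite expf_neq0//; apply: contra v0 => /eqP/enorm_eq0 ->.
set c := 2 / enorm v ^+ 2; set P := (conj_mx v)^T *m v.
have hP : (conj_mx P)^T = P.
  by apply/matrixP => i j; rewrite !mxE !big_ord1 !mxE cjM cjK mulrC.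
have PP : P *m P = Rc (enorm v ^+ 2) *: P.
  rewrite /P mulmxA -(mulmxA (conj_mx v)^T).
  have -> : v *m (conj_mx v)^T = (Rc (enorm v ^+ 2))%:M.
    by rewrite [LHS]mx11_scalar -cinner_mx cinnerzz.
  by rewrite mul_mx_scalar -scalemxAl.
rewrite /unitary_mx -/(conj_mx _).
have -> : (conj_mx (householder v))^T = householder v.
  apply/matrixP => i j; rewrite -/c -/P; have := congr1 (fun A : 'M[C]_d => A i j) hP.
  rewrite !mxE => <-; rewrite cjD cjN cjM cj_Rc.
  congr (_ - _); rewrite eq_sym; case: eqP => _; last by rewrite !mulr0n cj0.
  by rewrite !mulr1n cj1.
rewrite /householder -/c -/P mulmxBl mul1mx mulmxBr mulmx1 -scalemxAl -scalemxAr PP.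
have -> : Rc c *: (Rc c *: (Rc (enorm v ^+ 2) *: P)) = Rc c *: P + Rc c *: P.
  rewrite !scalerA -scalerDl -!RcM -RcD; congr (Rc _ *: _); rewrite /c; field.
  by move: n0; rewrite sqrf_eq0.
by rewrite opprB addrK subrK.
Qed.

Lemma householder_mul v z : z *m householder v =
  z - (Rc (2 / enorm v ^+ 2) * cinner z v) *: v.
Proof.
rewrite /householder mulmxBr mulmx1 -scalemxAr mulmxA.
by rewrite [z *m _]mx11_scalar -cinner_mx mul_scalar_mx scalerA.
Qed.

Lemma exists_phase (x : C) : exists2 c : C, cabs c = 1 & cj c * x = Rc (cabs x).
Proof.
have [->|x0] := eqVneq x 0; first by exists 1; rewrite ?cabs1// mulr0 cabs0.
have n0 : cabs x != 0 by rewrite cabs_eq0.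
exists (x / Rc (cabs x)).
  by rewrite cabsM cabsV cabs_Rc ger0_norm ?cabs_ge0// divff.
rewrite -RcV cjM cj_Rc mulrAC (mulrC (cj x)) mulC_cj -RcM expr2 mulfK//.
Qed.

(** The reflection in [a - b'] exchanges two unit vectors [a] and [b'] when their inner product is
    real. A phase [c] makes the inner product of [a] with [b' = c *: b] real, and the scalar matrix
    of [cj c] takes [b'] back to [b]. *)
Lemma unitary_transitive a b : enorm a = 1 -> enorm b = 1 ->
  exists2 U : 'M[C]_d, unitary_mx U & a *m U = b.
Proof.
move=> a1 b1; have [c c1 hc] := exists_phase (cinner a b).
pose b' := c *: b; have cc : cj c * c = 1.
  by rewrite mulrC mulC_cj c1 expr1n.
have b'1 : enorm b' = 1 by rewrite enormZ c1 mul1r.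
have cU : unitary_mx ((cj c)%:M : 'M[C]_d) by apply: unitary_scalar; rewrite cabs_cj.
have back : cj c *: b' = b by rewrite scalerA cc scale1r.
have [ab|ab] := eqVneq a b'.
  by exists (cj c)%:M => //; rewrite mul_mx_scalar ab.
exists (householder (a - b') *m (cj c)%:M).
  by apply: unitaryM => //; apply: householder_unitary; rewrite subr_eq0.
rewrite mulmxA mul_mx_scalar householder_mul.
have E : cinner a b' = Rc (cabs (cinner a b)) by rewrite cinnerZr.
have n0 : enorm (a - b') ^+ 2 != 0.
  by rewrite expf_neq0//; apply: contra ab => /eqP/enorm_eq0/subr0_eq ->.
have -> : Rc (2 / enorm (a - b') ^+ 2) * cinner a (a - b') = 1.
  rewrite cinnerDr cinnerNr cinnerzz a1 E -RcN -RcD -RcM -Rc1; congr Rc.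
  rewrite mulrAC (_ : 2 * (1 ^+ 2 - _) = enorm (a - b') ^+ 2) ?divff//.
  by rewrite enormB_sqr a1 b'1 E ReC_Rc; ring.
by rewrite scale1r opprB addrC subrK.
Qed.

Lemma enormB_dist z w : `|enorm z - enorm w| <= enorm (z - w).
Proof.
have := enormD_le z w; have := enormD_le w z; rewrite (enormBC w z) ler_norml; lra.
Qed.

Lemma nbhs_enormP z (A : set V) :
  nbhs z A <-> exists2 e : R, 0 < e & forall y, enorm (z - y) < e -> A y.
Proof.
split.
  move=> /nbhs_ballP[e /= e0 H].
  have eE : e = Rc (ReC e) by apply: Ceq => //; rewrite ImC_Rc; apply: ger0_Im; exact: ltW.
  have e0' : 0 < ReC e by move: e0; rewrite {1}eE ltcR.
  exists (ReC e) => // y hy; apply: H; split => // i j.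
  rewrite -ball_normE/= cabs_norm eE ltcR ord1.
  by apply: le_lt_trans hy; have := cabs_coord (z - y) j; rewrite !mxE.
move=> [e e0 H]; apply/nbhs_ballP.
(* The topology of row vectors is entrywise. Dividing by [d.+1] rather than [d] gives a strict
   inequality and covers dimension [0]. *)
have d0 : 0 < d.+1%:R :> R by rewrite ltr0n.
exists (Rc (e / d.+1%:R)) => /=; first by rewrite ltcR divr_gt0.
move=> y [_ hy]; apply: H.
apply: (@le_lt_trans _ _ (d%:R * (e / d.+1%:R))).
  apply: enorm_le_coord => [|k]; first by rewrite divr_ge0// ltW.
  have := hy ord0 k; rewrite -ball_normE/= cabs_norm ltcR => /ltW.
  by rewrite !mxE.
by rewrite mulrA ltr_pdivrMr// mulrC ltr_pM2l// ltr_nat.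
Qed.

Lemma continuous_enorm : continuous (@enorm R d).
Proof.
move=> z; apply/(@cvgrPdist_lt _ _ _ (nbhs z)) => e e0; apply/nbhs_enormP; exists e => // y.
by apply: le_lt_trans; exact: enormB_dist.
Qed.

Lemma compact_closed_ball : compact (@closed_unit_ball R d).
Proof.
apply: (@subclosed_compact _ _ [set v : V | forall i, disc (v ord0 i)]).
- rewrite (_ : @closed_unit_ball R d = @enorm R d @^-1` [set r | r <= 1])//.
  by apply: closed_comp => [x _|]; [exact: continuous_enorm|exact: closed_le].
- exact: (@rV_compact _ d (fun=> @disc R) (fun=> @compact_disc R)).
- by move=> z /= hz i; apply: le_trans hz; exact: cabs_coord.
Qed.

Lemma heine_cantor (h : V -> R) : {within @closed_unit_ball R d, continuous h} ->
  forall e, 0 < e -> exists2 dl, 0 < dl & forall z w,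
    closed_unit_ball z -> closed_unit_ball w -> enorm (z - w) < dl -> `|h z - h w| < e.
Proof.
move=> ch e e0.
have loc z : closed_unit_ball z -> exists2 dl, 0 < dl & forall w,
    closed_unit_ball w -> enorm (z - w) < dl -> `|h z - h w| < e / 2.
  move=> hz.
  have e2 : 0 < e / 2 by rewrite divr_gt0.
  move/subspace_continuousP: ch => /(_ z hz)/cvgrPdist_lt/(_ _ e2).
  by move=> /nbhs_enormP[dl dl0 H]; exists dl => // w hw /H/(_ hw).
(* Compactness in its near-covering form, with the radius [dl] tending to [0] from the right as
   parameter: the estimates near each point for small [dl] become one for all points. *)
have /compact_near_coveringP/(_ R (0^'+) (fun dl z => forall w, closed_unit_ball z ->
   closed_unit_ball w -> enorm (z - w) < dl -> `|h z - h w| < e)) := compact_closed_ball.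
move=> /(_ _)[].
  move=> z /loc[dl dl0 H]; exists ([set y | enorm (z - y) < dl / 2], [set s | s < dl / 2]) => /=.
    split; first by apply/nbhs_enormP; exists (dl / 2) => //; rewrite divr_gt0.
    by apply: nbhs_right_lt; rewrite divr_gt0.
  move=> [y s] [/= h1 h2] w hy hw yw.
  have h3 : `|h z - h y| < e / 2 by apply: H => //; lra.
  have h4 : `|h z - h w| < e / 2.
    apply: H => //; rewrite (_ : z - w = (z - y) + (y - w)); last by rewrite addrA subrK.
    by apply: le_lt_trans (enormD _ _) _; lra.
  by move: h3 h4; rewrite !ltr_norml; lra.
move=> dl /= dl0 H; exists (dl / 2); first by rewrite divr_gt0.
move=> z w hz hw zw; apply: (H (dl / 2)) => //=; last by rewrite divr_gt0.
by rewrite sub0r normrN gtr0_norm ?divr_gt0// ltr_pdivrMr// ltr_pMr// ltr1n.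
Qed.

End Sphere.

(** * Covering the sphere by non-isotropic balls *)

Section Cover.
Variables (R : realType) (d' : nat).
Notation d := d'.+1.
Notation C := (CC R).
Notation V := (Cd R d).

Lemma grid_approx (m : nat) (x : R) : `|x| <= 1 -> exists a : 'I_(2 * m.+1).+1,
  `|x - (a%:R - m.+1%:R) / m.+1%:R| <= m.+1%:R^-1.
Proof.
rewrite ler_norml => /andP[x1 x2]; have m0 : 0 < m.+1%:R :> R by rewrite ltr0n.
have u0 : 0 <= (x + 1) * m.+1%:R by rewrite mulr_ge0 ?(ltW m0)//; lra.
have /andP[k1 k2] := truncn_itv u0; set k := Num.truncn _ in k1 k2.
have kN : (k < (2 * m.+1).+1)%N.
  rewrite ltnS -(ler_nat R); apply: le_trans k1 _; rewrite natrM ler_pM2r//; lra.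
exists (Ordinal kN) => /=.
rewrite (_ : _ - _ = ((x + 1) * m.+1%:R - k%:R) / m.+1%:R); last by field; rewrite lt0r_neq0.
rewrite normrM (gtr0_norm (x := m.+1%:R^-1)) ?invr_gt0// ler_piMl ?invr_ge0 ?(ltW m0)//.
by move: k2; rewrite -natr1 ler_norml; lra.
Qed.

(** A chart, a grid point for each of the [d'] other coordinates, and a phase. In the shifted
    indexing of [rootu], [(m.+1 ^ 2).-1] stands for the roots of order [m.+1 ^ 2]. *)
Definition grid_index (m : nat) : finType :=
  ('I_d * {ffun 'I_d' -> 'I_(2 * m.+1).+1 * 'I_(2 * m.+1).+1} * 'I_((m.+1) ^ 2).-1.+1)%type.

Definition grid_coord (m : nat) (p : 'I_(2 * m.+1).+1 * 'I_(2 * m.+1).+1) : C :=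
  Complex ((p.1%:R - m.+1%:R) / m.+1%:R) ((p.2%:R - m.+1%:R) / m.+1%:R).

Definition grid_point (m : nat) (k : 'I_d)
    (g : {ffun 'I_d' -> 'I_(2 * m.+1).+1 * 'I_(2 * m.+1).+1}) : V :=
  \row_i (if unlift k i is Some j then grid_coord (g j) else 1).

Definition grid_center (m : nat) (i : grid_index m) : V :=
  let: (k, g, j) := i in
  rootu R j *: (Rc (enorm (grid_point k g))^-1 *: grid_point k g).

Lemma grid_point_ge1 m k g : 1 <= enorm (@grid_point m k g).
Proof.
by apply: le_trans (cabs_coord _ k); rewrite mxE unlift_none cabs1.
Qed.

Lemma grid_center_sphere m (i : grid_index m) : unit_sphere (grid_center i).
Proof.
case: i => [[k g] j]; rewrite /unit_sphere/= !enormZ cabs_rootu mul1r cabs_Rc.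
have h := grid_point_ge1 k g.
by rewrite ger0_norm ?invr_ge0 ?enorm_ge0// mulVf// gt_eqF// (lt_le_trans ltr01).
Qed.

(** There are [2 * d'] real grid directions with at most [3 * m.+1] points each, and [m.+1 ^ 2]
    phases. For a radius [delta] of order [1 / m.+1 ^ 2] the count is of order [delta^-d]. *)
Lemma card_grid_index m : (#|grid_index m| <= d * 9 ^ d' * m.+1 ^ (2 * d))%N.
Proof.
rewrite /grid_index !card_prod card_ffun !card_prod !card_ord prednK ?expn_gt0//.
have -> : (2 * d = 2 * d' + 2)%N by rewrite mulnS addnC.
rewrite expnD mulnA leq_mul2r; apply/orP; right.
rewrite -mulnA leq_mul2l /=; rewrite (expnM m.+1) -expnMn.
case: (d') => [//|n]; rewrite leq_exp2r// -mulnn.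
by rewrite (_ : 9 = 3 * 3)%N// mulnACA leq_mul// -addn1 -[in X in (_ <= X)%N](addn1 2) mulnDl leq_add2l mul1n.
Qed.

(* For the chart [z = z_k v], [v_k = 1], a grid of mesh [1/m] approximates [v], hence [z]
   up to a phase, within [1/m^2]; the phase is one of [m^2] roots of unity. *)
Lemma sphere_cover m (z : V) : unit_sphere z -> exists i : grid_index m,
  cabs (1 - cinner (grid_center i) z) <= (4 * pi + 4 * d%:R) / m.+1%:R ^+ 2.
Proof.
rewrite /unit_sphere/= => z1.
have [k _ hk] := arg_maxP (fun i => cabs (z ord0 i)) (erefl (predT (ord0 : 'I_d))).
have zk0 : z ord0 k != 0.
  apply/eqP => zk; move: (oner_neq0 R); rewrite -z1 => /eqP; apply.
  apply/eqP; rewrite -sqrf_eq0 enorm_sqr big1// => i _; apply/eqP; rewrite sqrf_eq0.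
  by rewrite eq_le cabs_ge0 andbT; have := hk i isT; rewrite zk cabs0.
have ck0 : 0 < cabs (z ord0 k) by rewrite cabs_gt0.
(* Division by a coordinate of largest modulus keeps the entries of [v] in the unit disc, the range
   of the grid. *)
pose v : V := (z ord0 k)^-1 *: z.
have vi i : cabs (v ord0 i) <= 1.
  by rewrite mxE cabsM cabsV mulrC ler_pdivrMr// mul1r; exact: hk.
have m0 : 0 < m.+1%:R :> R by rewrite ltr0n.
have hg j : exists p : 'I_(2 * m.+1).+1 * 'I_(2 * m.+1).+1,
    cabs (v ord0 (lift k j) - grid_coord p) <= 2 / m.+1%:R.
  have [a ha] := grid_approx m (le_trans (normReC _) (vi (lift k j))).
  have [b hb] := grid_approx m (le_trans (normImC _) (vi (lift k j))).
  exists (a, b); apply: le_trans (cabs_le_ReIm _) _; rewrite ReCB ImCB.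
  by rewrite mulrDl !mul1r; exact: lerD.
have [g0 hg0] := choice hg.
pose g := [ffun j => g0 j]; pose U := grid_point k g.
have eUV : enorm (v - U) ^+ 2 <= 4 * d%:R / m.+1%:R ^+ 2.
  rewrite enorm_sqr; apply: (@le_trans _ _ (\sum_(i < d) (2 / m.+1%:R) ^+ 2)).
    apply: ler_sum => i _; rewrite ler_pXn2r ?nnegrE ?cabs_ge0 ?divr_ge0 ?(ltW m0)//.
    rewrite !mxE; case: unliftP => [j ->|->]; first by rewrite ffunE; have := hg0 j; rewrite mxE.
    by rewrite mulVf// subrr cabs0 divr_ge0// ltW.
  rewrite sumr_const card_ord -[X in X <= _]mulr_natl le_eqVlt; apply/orP; left; apply/eqP.
  by field; rewrite lt0r_neq0.
set e2 := enorm (v - U) ^+ 2 in eUV.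
have V1 : 1 <= enorm v.
  by apply: le_trans (cabs_coord v k); rewrite mxE mulVf// cabs1.
have U1 : 1 <= enorm U := grid_point_ge1 k g.
have U0 : 0 < enorm U by exact: lt_le_trans U1.
have A1 : 1 <= enorm v ^+ 2 by rewrite exprn_ege1.
have B1 : 1 <= enorm U ^+ 2 by rewrite exprn_ege1.
set y := cinner (Rc (enorm U)^-1 *: U) z.
have y1 : cabs y <= 1.
  apply: le_trans (cauchy_schwarz _ _) _; rewrite z1 mulr1 enormZ cabs_Rc.
  by rewrite ger0_norm ?invr_ge0 ?(ltW U0)// mulVf// lt0r_neq0.
have zE : z = z ord0 k *: v by rewrite scalerA divff// scale1r.
have vz : cabs (z ord0 k) * enorm v = 1 by rewrite -enormZ -zE.
have yE : cabs y ^+ 2 * (enorm v ^+ 2 * enorm U ^+ 2) = cabs (cinner v U) ^+ 2.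
  rewrite -!exprMn /y cinnerZl [in cinner U z]zE cinnerZr !cabsM cabs_Rc cabs_cj.
  rewrite (cinnerC v U) cabs_cj ger0_norm ?invr_ge0 ?(ltW U0)//; congr (_ ^+ 2).
  rewrite (_ : _ * _ = (enorm U)^-1 * enorm U * (cabs (z ord0 k) * enorm v) * cabs (cinner v U)); last by ring.
  by rewrite vz mulVf ?mul1r// lt0r_neq0.
(* The Gram determinant of [v] and [U] is at most [|U|^2 |v - U|^2]. So the modulus of the
   normalized inner product differs from [1] by at most the square of the grid error: this is the
   gain from [1/m] to [1/m^2]. *)
have lag : enorm v ^+ 2 * enorm U ^+ 2 - cabs (cinner v U) ^+ 2 <= enorm U ^+ 2 * e2.
  rewrite /e2 enormB_sqr cabs_sqr; set a := ReC _; set b := ImC _.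
  have := sqr_ge0 (enorm U ^+ 2 - a); have := sqr_ge0 b; lra.
have e20 : 0 <= e2 by exact: sqr_ge0.
have yt : 1 - cabs y <= e2.
  have AB : 0 < enorm v ^+ 2 * enorm U ^+ 2 by rewrite mulr_gt0// (lt_le_trans ltr01).
  have : 1 - cabs y ^+ 2 <= e2.
    rewrite -(ler_pM2r AB) mulrBl mul1r yE; apply: le_trans lag _.
    by rewrite (mulrC (enorm U ^+ 2)) ler_wpM2l// ler_peMl// sqr_ge0.
  have := cabs_ge0 y; nra.
have [c c1 hc] := exists_phase y.
have [j hj] := rootu_net (m.+1 ^ 2).-1 (etrans (cabs_cj c) c1).
exists (k, g, j); rewrite /grid_center -/U cinnerZl -/y.
rewrite (_ : 1 - _ = (1 - cj c * y) + (cj c - rootu R j) * y); last by ring.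
apply: le_trans (cabsD _ _) _.
rewrite [leRHS](_ : _ = 4 * d%:R / m.+1%:R ^+ 2 + 4 * pi / m.+1%:R ^+ 2); last first.
  by rewrite -mulrDl addrC.
apply: lerD.
  rewrite hc -Rc1 -RcN -RcD cabs_Rc ger0_norm ?subr_ge0//.
  exact: le_trans eUV.
rewrite cabsM -[leRHS]mulr1; apply: ler_pM; rewrite ?cabs_ge0//.
by apply: le_trans hj _; rewrite prednK ?expn_gt0// natrX.
Qed.

End Cover.

(** * Measurability and the surface measure *)

Section Fubini.
Context {disp1 disp2 : measure_display} {T1 : measurableType disp1} {T2 : measurableType disp2}
  {R : realType}.
Variables (m1 : {measure set T1 -> \bar R}) (m2 : {measure set T2 -> \bar R}).
Hypothesis fin1 : (m1 setT < +oo)%E.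
Hypothesis fin2 : (m2 setT < +oo)%E.

(** Restricting to the whole space gives a measure of finite mass the structure under which
    Fubini-Tonelli applies; the integrals do not change. *)
Lemma integral_mfrestr (disp : measure_display) (T : measurableType disp)
  (m : {measure set T -> \bar R}) (h : (m setT < +oo)%E) (f : T -> \bar R) :
  (\int[mfrestr measurableT h]_x f x = \int[m]_x f x)%E.
Proof. apply: eq_measure_integral => A mA _.
by transitivity (m (A `&` setT)) => //; rewrite setIT. Qed.

Lemma fubini_fin (f : T1 * T2 -> \bar R) : measurable_fun setT f -> (forall p, 0 <= f p)%E ->
  (\int[m1]_x \int[m2]_y f (x, y) = \int[m2]_y \int[m1]_x f (x, y))%E.
Proof.
move=> mf f0.
have := @fubini_tonelli _ _ _ _ R (mfrestr measurableT fin1) (mfrestr measurableT fin2) f mf f0.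
rewrite !integral_mfrestr; under eq_integral do rewrite integral_mfrestr.
by move=> ->; apply: eq_integral => y _; rewrite integral_mfrestr.
Qed.

Lemma measurable_fubini_fin (f : T1 * T2 -> \bar R) : measurable_fun setT f -> (forall p, 0 <= f p)%E ->
  measurable_fun setT (fun x => \int[m2]_y f (x, y))%E.
Proof.
move=> mf f0.
have := @measurable_fun_fubini_tonelli_F _ _ _ _ R (mfrestr measurableT fin2) f mf f0.
by rewrite /fubini_F; under eq_fun do rewrite integral_mfrestr.
Qed.

End Fubini.

Section Borel.
Variables (R : realType) (d : nat).
Notation C := (CC R).
Notation V := (Cd R d).
Notation B := (BorelCd R d).

Lemma open_borel (A : set V) : open A -> measurable (A : set B).
Proof. exact: sub_sigma_algebra. Qed.

Lemma closed_borel (A : set V) : closed A -> measurable (A : set B).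
Proof. by move=> cA; rewrite -(setCK A); apply: measurableC; apply: open_borel; exact: closed_openC. Qed.

Lemma continuous_borel (h : V -> R) : continuous h -> measurable_fun setT (h : B -> R).
Proof.
move=> /continuousP ch; apply: (measurability _ (RGenOpens.measurableE R)).
move=> _ [_ [a [b ->] <-]]; rewrite setTI; apply: open_borel.
exact/ch/interval_open.
Qed.

Lemma continuous_within_borel (A : set V) (h : V -> R) : closed A ->
  {within A, continuous h} -> measurable_fun (A : set B) (h : B -> R).
Proof.
move=> cA /continuousP ch; apply: (measurability _ (RGenOpens.measurableE R)).
move=> _ [_ [a [b ->] <-]].
have /open_subspaceP[W oW WE] := ch _ (interval_open (a := BRight a) (b := BLeft b) isT isT).
by rewrite setIC -WE; apply: measurableI; [exact: open_borel|exact: closed_borel].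
Qed.

Lemma closed_sphere : closed (@unit_sphere R d).
Proof.
rewrite (_ : @unit_sphere R d = @enorm R d @^-1` [set r | r = 1])//.
by apply: closed_comp => [x _|]; [exact: continuous_enorm|exact: closed_eq].
Qed.

Lemma closed_ball1 : closed (@closed_unit_ball R d).
Proof.
rewrite (_ : @closed_unit_ball R d = @enorm R d @^-1` [set r | r <= 1])//.
by apply: closed_comp => [x _|]; [exact: continuous_enorm|exact: closed_le].
Qed.

Lemma sphere_borel : measurable (@unit_sphere R d : set B). 
Proof. exact: closed_borel closed_sphere. Qed.

Lemma ball_borel : measurable (@closed_unit_ball R d : set B).
Proof. exact: closed_borel closed_ball1. Qed.

Lemma coord_borel k : measurable_fun setT (fun z : B => ReC ((z : V) ord0 k)) /\
  measurable_fun setT (fun z : B => ImC ((z : V) ord0 k)).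
Proof.
split; apply: continuous_borel => z; apply: (continuous_comp (@coord_continuous _ _ _ ord0 k z)).
  exact: continuous_ReC.
exact: continuous_ImC.
Qed.

Lemma cabs_borel (disp : measure_display) (T : measurableType disp) (u : T -> C) :
  measurable_fun setT (fun x => ReC (u x)) -> measurable_fun setT (fun x => ImC (u x)) ->
  measurable_fun setT (fun x => cabs (u x)).
Proof.
move=> m1 m2; under eq_fun do rewrite cabsE.
apply: (measurableT_comp (continuous_measurable_fun (@sqrt_continuous R))).
by apply: measurable_funD; exact: measurable_funX.
Qed.

(* Joint measurability of [(z, w) |-> |1 - <r z, w>|] with respect to the product
   sigma-algebra, read off from its coordinate expression. *)
Lemma kernel_den_borel (r : R) :
  measurable_fun setT (fun p : B * B => cabs (1 - Rc r * cinner (p.1 : V) (p.2 : V))).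
Proof.
have m1 k : measurable_fun setT (fun p : B * B => ReC ((p.1 : V) ord0 k)).
  exact: (measurableT_comp (coord_borel k).1 measurable_fst).
have m2 k : measurable_fun setT (fun p : B * B => ImC ((p.1 : V) ord0 k)).
  exact: (measurableT_comp (coord_borel k).2 measurable_fst).
have m3 k : measurable_fun setT (fun p : B * B => ReC ((p.2 : V) ord0 k)).
  exact: (measurableT_comp (coord_borel k).1 measurable_snd).
have m4 k : measurable_fun setT (fun p : B * B => ImC ((p.2 : V) ord0 k)).
  exact: (measurableT_comp (coord_borel k).2 measurable_snd).
have mR : measurable_fun setT (fun p : B * B => ReC (cinner (p.1 : V) (p.2 : V))).
  under eq_fun do rewrite cinnerE ReC_sum; apply: measurable_sum => k.
  under eq_fun do rewrite ReCM ReC_cj ImC_cj mulrN opprK.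
  by apply: measurable_funD; exact: measurable_funM.
have mI : measurable_fun setT (fun p : B * B => ImC (cinner (p.1 : V) (p.2 : V))).
  under eq_fun do rewrite cinnerE ImC_sum; apply: measurable_sum => k.
  under eq_fun do rewrite ImCM ReC_cj ImC_cj mulrN addrC.
  by apply: measurable_funB; exact: measurable_funM.
apply: cabs_borel.
  under eq_fun do rewrite ReCB ReC1 ReCM ReC_Rc ImC_Rc mul0r subr0.
  by apply: measurable_funB => //; exact: measurable_funM.
under eq_fun do rewrite ImCB ImC1 ImCM ReC_Rc ImC_Rc mul0r addr0.
by apply: measurable_funB => //; exact: measurable_funM.
Qed.

Lemma nonisotropic_borel (zeta : V) (dl : R) : measurable (nonisotropic_ball zeta dl : set B).
Proof.
rewrite (_ : nonisotropic_ball zeta dl = @unit_sphere R d `&` [set xi | cabs (1 - cinner zeta xi) <= dl])//.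
apply: measurable_fun_le => //; first exact: sphere_borel.
apply: measurable_funTS.
have := measurableT_comp (kernel_den_borel 1) (pair1_measurable (zeta : B)).
by apply: eq_measurable_fun => w _ /=; rewrite Rc1 mul1r.
Qed.

End Borel.

(** * Unitary invariance of the surface measure *)

Section Surface.
Variables (R : realType) (d : nat) (sigma : {measure set BorelCd R d -> \bar R}).
Notation C := (CC R).
Notation V := (Cd R d).
Notation B := (BorelCd R d).
Notation S := (@unit_sphere R d : set B).
Hypothesis hs : is_normalized_surface_measure sigma.

Lemma sigmaT : sigma setT = 1%E. Proof. by case: hs. Qed.

Lemma sigma_fin : (sigma setT < +oo)%E. Proof. by rewrite sigmaT ltry. Qed.

Lemma sigmaS : sigma S = 1%E.
Proof.
case: hs => h1 h2 _; have mS : measurable S := @sphere_borel R d.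
have e := measureU sigma mS (measurableC mS) (setICr _).
rewrite setUv in e; rewrite -[LHS]adde0 -h2; exact: etrans (esym e) h1.
Qed.

Lemma mulU_borel (U : 'M[C]_d) : unitary_mx U -> measurable_fun setT ((fun z : V => z *m U) : B -> B).
Proof.
move=> hU; apply: (@measurability _ _ B B setT (fun z : V => z *m U) (@open V : set (set B)) (erefl _)).
move=> _ [A oA <-]; rewrite setTI; apply: open_borel.
move: A oA; apply/continuousP => z A /nbhs_enormP[e e0 H].
apply/nbhs_enormP; exists e => // y zy; apply: H.
by rewrite -mulmxBl enormU.
Qed.

Lemma sphereU (U : 'M[C]_d) : unitary_mx U -> (fun z : V => z *m U) @^-1` (@unit_sphere R d) = @unit_sphere R d.
Proof. by move=> hU; apply/seteqP; split => z /=; rewrite /unit_sphere/= enormU. Qed.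

Lemma integral_sphereU (U : 'M[C]_d) (f : B -> \bar R) : unitary_mx U ->
  measurable_fun S f -> (forall z, S z -> 0 <= f z)%E ->
  (\int[sigma]_(z in S) f ((z : V) *m U : V) = \int[sigma]_(z in S) f z)%E.
Proof.
move=> hU mf f0; pose phi : B -> B := fun z : V => z *m U.
have mphi : measurable_fun setT phi := mulU_borel hU.
have mS : measurable S := @sphere_borel R d.
have := @ge0_integral_pushforward _ _ _ _ _ phi mphi sigma S f mS mf.
rewrite (sphereU hU) => <-; last by move=> z; rewrite inE; exact: f0.
apply: eq_measure_integral => A mA _.
by case: hs => _ _ /(_ U hU A mA).
Qed.

Lemma sigma_ball_eq (z w : V) (dl : R) : S z -> S w ->
  sigma (nonisotropic_ball z dl) = sigma (nonisotropic_ball w dl).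
Proof.
move=> z1 w1; have [U hU zU] := unitary_transitive z1 w1.
case: hs => _ _ /(_ U hU _ (nonisotropic_borel w dl)) <-; congr (sigma _).
apply/seteqP; split=> y; rewrite /nonisotropic_ball/= /unit_sphere/= enormU// -zU cinnerU//.
Qed.

Lemma sigma_le1 (A : set B) : measurable A -> (sigma A <= 1)%E.
Proof. by move=> mA; rewrite -sigmaT; apply: le_measure; rewrite ?inE. Qed.

Lemma sigma_fin_num (A : set B) : measurable A -> sigma A \is a fin_num.
Proof.
move=> mA; rewrite ge0_fin_numE; last exact: measure_ge0.
by apply: le_lt_trans (sigma_le1 mA) _; rewrite ltry.
Qed.

End Surface.

Section SurfaceLower.
Variables (R : realType) (d' : nat) (sigma : {measure set BorelCd R d'.+1 -> \bar R}).
Notation d := d'.+1.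
Notation C := (CC R).
Notation V := (Cd R d).
Notation B := (BorelCd R d).
Notation S := (@unit_sphere R d : set B).
Hypothesis hs : is_normalized_surface_measure sigma.

Definition cover_radius (m : nat) : R := (4 * pi + 4 * d%:R) / m.+1%:R ^+ 2.

Lemma sigma_ball_ge (z : V) (m : nat) : S z ->
  ((((d * 9 ^ d')%N%:R * m.+1%:R ^+ (2 * d))^-1)%:E <= sigma (nonisotropic_ball z (cover_radius m)))%E.
Proof.
move=> z1; have mS : measurable S := @sphere_borel R d.
have mQ (i : grid_index d' m) : measurable (nonisotropic_ball (grid_center R i) (cover_radius m) : set B).
  exact: nonisotropic_borel.
have sub : S `<=` \bigcup_(i in [set: grid_index d' m]) nonisotropic_ball (grid_center R i) (cover_radius m).
  by move=> w hw; have [i hi] := sphere_cover m hw; exists i.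
have : (sigma S <= \sum_(i \in [set: grid_index d' m])
    sigma (nonisotropic_ball (grid_center R i) (cover_radius m)))%E.
  by apply: content_sub_fsum => //; exact: finite_finset.
have -> : [set: grid_index d' m] = [set` enum (grid_index d' m)].
  by apply/seteqP; split=> i //= _; rewrite mem_enum.
rewrite (sigmaS hs) -fsbig_seq ?enum_uniq// big_enum/=.
under eq_bigr do rewrite (sigma_ball_eq hs _ (grid_center_sphere R _) z1).
have fQ := sigma_fin_num hs (nonisotropic_borel z (cover_radius m)).
rewrite -(fineK fQ) lee_fin; set s := fine _.
rewrite sumEFin lee_fin => h.
have s0 : 0 <= s by rewrite fine_ge0// measure_ge0.
have N0 : 0 < (d * 9 ^ d')%N%:R * m.+1%:R ^+ (2 * d) :> R.
  by rewrite mulr_gt0 ?exprn_gt0 ?ltr0n// muln_gt0 expn_gt0.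
rewrite -[leLHS]mul1r ler_pdivrMr//; apply: le_trans h _.
rewrite sumr_const -[X in X <= _]mulr_natl mulrC ler_wpM2l// -natrX -natrM ler_nat.
exact: card_grid_index.
Qed.

End SurfaceLower.

(** * Boundary values control the Hardy norm *)

Section Within.
Variable R : realType.

Lemma within_comp (T U W : topologicalType) (A : set T) (K : set U) (phi : T -> U) (h : U -> W) :
  continuous phi -> (forall x, A x -> K (phi x)) -> {within K, continuous h} ->
  {within A, continuous (fun x => h (phi x))}.
Proof.
move=> cphi HA /subspace_continuousP ch; apply/subspace_continuousP => x Ax D nD.
have H1 : nbhs x [set y | K (phi y) -> D (h (phi y))] := cphi x _ (ch _ (HA x Ax) D nD).
change (nbhs x [set y | A y -> D (h (phi y))]).
by apply: filterS H1 => y /= H /HA; exact: H.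
Qed.

(** Away from [0] the power is differentiable; at [0] the radius is the inverse power of [e]. The
    absolute value makes this a statement on the whole line, to be composed with [cabs]. *)
Lemma continuous_abs_powR (p : R) : 0 < p -> continuous (fun t : R => `|t| `^ p).
Proof.
move=> p0 t; have [->|t0] := eqVneq t 0.
  apply/cvgrPdist_lt => e e0; rewrite normr0 powR0 ?lt0r_neq0//.
  have e1 : 0 < e `^ p^-1 by rewrite powR_gt0.
  apply/nbhs_ballP; exists (e `^ p^-1) => //= s; rewrite /ball/= !sub0r !normrN => hs.
  rewrite ger0_norm ?powR_ge0// -[ltRHS](powRr1 (ltW e0)) -(mulVf (lt0r_neq0 p0)) powRrM.
  by apply: gt0_ltr_powR; rewrite ?nnegrE ?powR_ge0.
apply: (@continuous_comp _ _ _ (fun t : R => `|t|) (fun s : R => s `^ p)).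
  exact: norm_continuous.
apply/differentiable_continuous/derivable1_diffP; apply: derivable_powR.
by rewrite in_itv/= andbT normr_gt0.
Qed.

Lemma within_cabs_powR (T : topologicalType) (A : set T) (f : T -> CC R) (p : R) : 0 < p ->
  {within A, continuous f} -> {within A, continuous (fun z => cabs (f z) `^ p)}.
Proof.
move=> p0 cf; rewrite (_ : (fun z => _) = (fun t : R => `|t| `^ p) \o (@cabs R \o f)); last first.
  by apply/funext => z /=; rewrite ger0_norm ?cabs_ge0.
apply: cont_sub_comp; last exact: continuous_abs_powR.
by apply: cont_sub_comp => //; exact: continuous_cabs.
Qed.

End Within.

Section HpBound.
Variables (R : realType) (d : nat) (sigma : {measure set BorelCd R d -> \bar R}).
Notation C := (CC R).
Notation V := (Cd R d).
Notation B := (BorelCd R d).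
Notation S := (@unit_sphere R d : set B).
Notation K := (@closed_unit_ball R d : set B).
Hypothesis hs : is_normalized_surface_measure sigma.

Lemma sub_sphere_ball : S `<=` K.
Proof. by move=> z /= h; rewrite /closed_unit_ball/= h. Qed.

Lemma within_ball_bounded (h : V -> R) : {within @closed_unit_ball R d, continuous h} ->
  exists2 M, 0 <= M & forall z, closed_unit_ball z -> `|h z| <= M.
Proof.
move=> ch; have cn : {within @closed_unit_ball R d, continuous (fun z => `|h z|)}.
  by apply: (@cont_sub_comp _ _ _ _ h (fun t : R => `|t|)) => //; exact: norm_continuous.
have ne : @closed_unit_ball R d !=set0.
  by exists 0; rewrite /closed_unit_ball/= /enorm cinner0l sqrtr0.
have [z0 _ hz] := compact_EVT_max ne (@compact_closed_ball R d) cn.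
by exists `|h z0| => // z hz'; apply: hz; rewrite inE.
Qed.

Lemma within_ball_measurable (h : V -> R) : {within @closed_unit_ball R d, continuous h} ->
  measurable_fun K (h : B -> R).
Proof. by apply: continuous_within_borel; exact: closed_ball1. Qed.

Lemma sphere_integral_bound (h : V -> R) (M : R) : measurable_fun S (h : B -> R) ->
  (forall z, S z -> 0 <= h z <= M) ->
  (0 <= \int[sigma]_(z in S) (h z)%:E <= M%:E)%E.
Proof.
move=> mh hM; have mS : measurable S := @sphere_borel R d.
apply/andP; split.
  by apply: integral_ge0 => z /hM/andP[? _]; rewrite lee_fin.
have : (\int[sigma]_(z in S) (h z)%:E <= \int[sigma]_(z in S) (cst M%:E) z)%E.
  apply: ge0_le_integral => //.
  - by move=> z /hM/andP[? _]; rewrite lee_fin.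
  - exact/measurable_EFinP.
  - by move=> z /hM/andP[_ ?]; rewrite lee_fin.
by rewrite integral_cst// (sigmaS hs) mule1.
Qed.

Lemma slice_differentiable (f : V -> C) (v : V) (x : C) : holomorphic_on_ball f ->
  enorm (x *: v) < 1 -> differentiable (fun y : C => f (y *: v)) x.
Proof.
move=> hf xv; apply: (@differentiable_comp _ _ _ _ (fun y : C => y *: v) f); last exact: hf.
exact: ex_diff.
Qed.

Lemma continuous_scalel (v : V) : continuous (fun y : C => y *: v).
Proof. exact: scalel_continuous. Qed.

Lemma continuous_scaler (c : C) : continuous (fun z : V => c *: z).
Proof. exact: scaler_continuous. Qed.

Lemma scale_ball (c : C) (z : V) : cabs c <= 1 -> closed_unit_ball z -> closed_unit_ball (c *: z).
Proof.
rewrite /closed_unit_ball/= enormZ => c1 z1; rewrite -[leRHS]mulr1.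
by apply: ler_pM; rewrite ?cabs_ge0 ?enorm_ge0.
Qed.

Variables (p : R) (f : V -> C).
Hypothesis p0 : 0 < p.
Hypothesis cf : {within @closed_unit_ball R d, continuous f}.
Hypothesis hf : holomorphic_on_ball f.

Let h (z : V) : R := cabs (f z) `^ p.

Let ch : {within @closed_unit_ball R d, continuous h}.
Proof. exact: within_cabs_powR. Qed.

(** The number of roots depends only on the modulus of continuity of [h], not on [z] or [r], so the
    inequality can be integrated over the sphere. *)
Lemma sum_rootu_le (e : R) : 0 < e -> exists N : nat, forall (z : V) (r : R), S z -> 0 < r < 1 ->
  \sum_(k < N.+1) h (Rc r *: (rootu R k *: z)) <= \sum_(k < N.+1) (h (rootu R k *: z) + e).
Proof.
move=> e0; have [dl dl0 hdl] := heine_cantor ch e0.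
have pi0 := @pi_gt0 R; pose q := 4 * pi / dl.
have q0 : 0 <= q by rewrite divr_ge0 ?mulr_ge0 ?(ltW pi0) ?(ltW dl0).
exists (Num.truncn q) => z r z1 /andP[r0 r1].
set N := Num.truncn q; have qN : 4 * pi / N.+1%:R < dl.
  have /andP[_ hq] := truncn_itv q0.
  by rewrite ltr_pdivrMr ?ltr0n// -ltr_pdivrMl// mulrC.
have v1 (k : 'I_N.+1) : enorm (rootu R k *: z) = 1 by rewrite enormZ cabs_rootu mul1r.
have H := @max_sum_powR R N.+1 (fun k x => f (x *: (rootu R k *: z))) p
  (\sum_(k < N.+1) (h (rootu R k *: z) + e)) p0.
apply: (H _ _ _ (Rc r)).
- by move=> k x x1; apply: slice_differentiable => //; rewrite enormZ v1 mulr1.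
- move=> k; apply: (@within_comp _ _ _ _ (@closed_unit_ball R d)) => //; first exact: continuous_scalel.
  by move=> x x1; apply: scale_ball => //; rewrite /closed_unit_ball/= v1.
- move=> x x1; have [j hj] := rootu_net N x1.
  (* Rotation by a root [rootu R j] close to [x] permutes the roots of unity, after which the two
     sums are compared term by term. *)
  rewrite [leRHS](reindex_inj (addrI j))/=; apply: ler_sum => k _.
  rewrite -/(h _) rootuD -scalerA.
  have K1 y : cabs y = 1 -> closed_unit_ball (y *: (rootu R k *: z)).
    by move=> y1; rewrite /closed_unit_ball/= enormZ y1 v1 mulr1.
  have := hdl (x *: (rootu R k *: z)) (rootu R j *: (rootu R k *: z)) (K1 _ x1) (K1 _ (cabs_rootu _ _)).
  rewrite -scalerBl enormZ v1 mulr1 => /(_ (le_lt_trans hj qN)).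
  by move/ltW; rewrite ler_norml => /andP[_]; rewrite lerBlDr addrC.
- by rewrite cabs_Rc gtr0_norm// ltW.
Qed.

Lemma Hp_pow_le : (Hp_pow sigma p f <= \int[sigma]_(z in S) (h z)%:E)%E.
Proof.
have mS : measurable S := @sphere_borel R d.
have [M M0 hM] := within_ball_bounded ch.
have hM' z : closed_unit_ball z -> 0 <= h z <= M.
  by move=> /hM; rewrite ger0_norm ?powR_ge0// => ->; rewrite powR_ge0.
have cc c : cabs c <= 1 -> {within @closed_unit_ball R d, continuous (fun z => h (c *: z))}.
  move=> c1; apply: (@within_comp _ _ _ _ (@closed_unit_ball R d)) ch; first exact: continuous_scaler.
  by move=> z; exact: scale_ball.
have mc c : cabs c <= 1 -> measurable_fun S (fun z : B => h (c *: (z : V))).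
  move=> /cc/within_ball_measurable; apply: measurable_funS; first exact: ball_borel.
  exact: sub_sphere_ball.
have bc c : cabs c <= 1 -> (0 <= \int[sigma]_(z in S) (h (c *: (z : V)))%:E <= M%:E)%E.
  move=> c1; apply: sphere_integral_bound; first exact: mc.
  by move=> z /sub_sphere_ball hz; apply: hM'; exact: scale_ball.
have fc c : cabs c <= 1 -> (\int[sigma]_(z in S) (h (c *: (z : V)))%:E)%E \is a fin_num.
  move=> /bc/andP[b1 b2]; rewrite ge0_fin_numE//; exact: le_lt_trans b2 (ltry _).
have inv c x : cabs x = 1 -> cabs c <= 1 ->
    (\int[sigma]_(z in S) (h (c *: (x *: (z : V))))%:E = \int[sigma]_(z in S) (h (c *: (z : V)))%:E)%E.
  move=> x1 c1.
  rewrite -(integral_sphereU hs (unitary_scalar d x1) (f := fun z : B => (h (c *: (z : V)))%:E)).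
  - by apply: eq_integral => z _; rewrite mul_mx_scalar.
  - by apply/measurable_EFinP; exact: mc.
  - by move=> z _; rewrite lee_fin powR_ge0.
suff key r : 0 < r < 1 ->
    (\int[sigma]_(z in S) (h (Rc r *: (z : V)))%:E <= \int[sigma]_(z in S) (h z)%:E)%E.
  by apply: ge_ereal_sup => y [r /= r01 <-]; rewrite in_itv/= in r01; exact: key.
move=> r01.
have r1 : cabs (Rc r) <= 1 by rewrite cabs_Rc; case/andP: r01 => ? ?; rewrite gtr0_norm// ltW.
have c11 : cabs (1 : C) <= 1 by rewrite cabs1.
have mul1 N c k : cabs c <= 1 -> cabs (c * rootu R (k : 'I_N.+1)) <= 1.
  by move=> c1; rewrite cabsM cabs_rootu mulr1.
have mk N c (k : 'I_N.+1) : cabs c <= 1 -> measurable_fun S (fun z : B => h (c *: (rootu R k *: (z : V)))).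
  by move=> c1; under eq_fun do rewrite scalerA; apply: mc; exact: mul1.
have sumE N c : cabs c <= 1 -> (\int[sigma]_(z in S) (\sum_(k < N.+1) h (c *: (rootu R k *: (z : V))))%:E =
   N.+1%:R%:E * \int[sigma]_(z in S) (h (c *: (z : V)))%:E)%E.
  move=> c1; under eq_integral do rewrite -sumEFin.
  rewrite ge0_integral_sum//; last 2 first.
  - by move=> k; apply/measurable_EFinP; exact: mk.
  - by move=> k z _; rewrite lee_fin powR_ge0.
  rewrite (eq_bigr (fun=> \int[sigma]_(z in S) (h (c *: (z : V)))%:E)%E).
    by rewrite sumr_const card_ord mule_natl.
  by move=> k _; rewrite inv ?cabs_rootu.
(* The right-hand integrand is written with [1 *: z] so that [sumE] covers both sides, with
   [c = Rc r] and with [c = 1]. *)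
have L e : 0 < e -> (\int[sigma]_(z in S) (h (Rc r *: (z : V)))%:E <=
    \int[sigma]_(z in S) (h ((1 : C) *: (z : V)))%:E + e%:E)%E.
  move=> e0; have [N hN] := sum_rootu_le e0.
  have n0 : (0 < N.+1%:R%:E :> \bar R)%E by rewrite lte_fin ltr0n.
  rewrite -(@lee_pmul2l _ N.+1%:R%:E)//.
  rewrite -sumE// ge0_muleDr; [|by case/andP: (bc _ c11)|by rewrite lee_fin ltW].
  have -> : (N.+1%:R%:E * e%:E)%E = (\int[sigma]_(z in S) (cst (N.+1%:R * e)%:E) z)%E.
    by rewrite integral_cst// (sigmaS hs) mule1 EFinM.
  rewrite -sumE// -ge0_integralD//.
  - apply: ge0_le_integral => //.
    + by move=> z _; rewrite lee_fin sumr_ge0// => k _; exact: powR_ge0.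
    + by apply/measurable_EFinP; apply: measurable_sum => k; exact: mk.
    + apply: emeasurable_funD => //.
      by apply/measurable_EFinP; apply: measurable_sum => k; exact: mk.
    + move=> z z1; rewrite -EFinD lee_fin; apply: le_trans (hN z r z1 r01) _.
      rewrite big_split/= sumr_const card_ord -[e *+ _]mulr_natl lerD2r.
      by under [leRHS]eq_bigr do rewrite scale1r.
  - by move=> z _; rewrite lee_fin sumr_ge0// => k _; exact: powR_ge0.
  - by apply/measurable_EFinP; apply: measurable_sum => k; exact: mk.
  - by move=> z _; rewrite lee_fin mulr_ge0// ltW.
apply: (@le_trans _ _ (\int[sigma]_(z in S) (h ((1 : C) *: (z : V)))%:E)%E).
  by apply/lee_addgt0Pr => e e0; exact: L.
by under eq_integral do rewrite scale1r.
Qed.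

End HpBound.

(** * From non-isotropic balls to continuous functions *)

Section RealIntegral.
Variables (disp : measure_display) (T : measurableType disp) (R : realType).
Variable m : {measure set T -> \bar R}.

Lemma ge0_integralZ_real (D : set T) (f : T -> R) (k : R) : measurable D ->
  measurable_fun D f -> (forall x, D x -> 0 <= f x) -> 0 <= k ->
  (\int[m]_(x in D) (k * f x)%:E = k%:E * \int[m]_(x in D) (f x)%:E)%E.
Proof.
move=> mD mf f0 k0; under eq_integral do rewrite EFinM.
by apply: ge0_integralZl_EFin => //;
exact/measurable_EFinP.
Qed.

Lemma integral_scale_indic (A : set T) (k : R) : measurable A -> 0 <= k ->
  (\int[m]_x (k * \1_A x)%:E = k%:E * m A)%E.
Proof.
move=> mA k0.
have mi : measurable_fun setT (\1_A : T -> R) by exact/measurable_indicP.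
have i0 x : setT x -> 0 <= \1_A x :> R by rewrite indicE.
rewrite (ge0_integralZ_real measurableT mi i0 k0).
by rewrite integral_indic// setIT.
Qed.

End RealIntegral.

Section SphereDomination.
Variables (R : realType) (d' : nat).
Notation d := d'.+1.
Variables (sigma mu : {measure set BorelCd R d -> \bar R}).
Notation C := (CC R).
Notation V := (Cd R d).
Notation B := (BorelCd R d).
Notation S := (@unit_sphere R d : set B).
Notation K := (@closed_unit_ball R d : set B).
Hypothesis hs : is_normalized_surface_measure sigma.
Hypothesis fmu : (mu setT < +oo)%E.

Lemma sphere_nonempty : exists z : V, unit_sphere z.
Proof.
exists (delta_mx ord0 ord0); rewrite /unit_sphere/=; apply/eqP.
rewrite -(@eqrXn2 _ 2)// ?enorm_ge0// expr1n enorm_sqr (bigD1 ord0)//= mxE !eqxx cabs1 expr1n.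
by rewrite big1 ?addr0// => k k0; rewrite mxE (negbTE k0) andbF cabs0 expr0n.
Qed.

Lemma cover_radius_small (dl : R) : 0 < dl -> exists m, cover_radius R d' m <= dl.
Proof.
move=> dl0; have pi0 := @pi_gt0 R.
pose a : R := 4 * pi + 4 * d%:R.
have a0 : 0 <= a by rewrite addr_ge0// mulr_ge0 ?(ltW pi0).
have q0 : 0 <= a / dl by rewrite divr_ge0// ltW.
exists (Num.truncn (a / dl)); rewrite /cover_radius -/a; set m := Num.truncn _.
have /andP[_ hm] := truncn_itv q0; rewrite -/m in hm.
have m1 : 1 <= m.+1%:R :> R by rewrite ler1n.
rewrite ler_pdivrMr ?exprn_gt0 ?ltr0n//.
rewrite mulrC -ler_pdivrMr//; apply: le_trans (ltW hm) _.
by rewrite expr2 ler_peMl// ler0n.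
Qed.

Lemma sigma_ball_gt0 (z : V) (dl : R) : S z -> 0 < dl -> (0 < sigma (nonisotropic_ball z dl))%E.
Proof.
move=> z1 /cover_radius_small[m hm].
apply: lt_le_trans (le_trans (sigma_ball_ge hs m z1) _).
  by rewrite lte_fin invr_gt0 mulr_gt0 ?exprn_gt0 ?ltr0n// muln_gt0 expn_gt0.
apply: le_measure; rewrite ?inE; try exact: nonisotropic_borel.
by move=> w [w1 w2]; split => //; exact: le_trans hm.
Qed.

Lemma nonisotropic_ballC (z w : V) (dl : R) : S z -> S w ->
  nonisotropic_ball z dl w -> nonisotropic_ball w dl z.
Proof.
move=> z1 w1 [_ h]; split => //; move: h.
by rewrite (cinnerC w z) -[cabs (1 - _)]cabs_cj cjD cjN cj1 cjK.
Qed.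

Lemma nonisotropic_borel2 (dl : R) :
  measurable [set p : B * B | S p.1 /\ nonisotropic_ball (p.1 : V) dl (p.2 : V)].
Proof.
have mS : measurable S := @sphere_borel R d.
rewrite (_ : mkset _ = (S `*` S) `&` [set p : B * B | cabs (1 - Rc 1 * cinner (p.1 : V) (p.2 : V)) <= dl]).
  apply: measurable_fun_le => //; first exact: measurableX.
  by apply: measurable_funTS; exact: kernel_den_borel.
by apply/seteqP; split=> [[z w] /= [z1 [w1 h]]|[z w] /= [[z1 w1] h]]; rewrite ?mul1r in h *;
  split => //; split.
Qed.

(** The relation between [z] and [w] defined by a ball of fixed radius is symmetric. So for fixed
    [w] the integral over [z] of [h z] on this relation is at most [h w + e] times the measure of
    the ball around [w]. That measure is the same positive number [s] for all centers and
    cancels. *)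
Lemma sphere_domination (c : R) (h : V -> R) : 0 < c ->
  (forall z dl, S z -> 0 < dl ->
    (c%:E * sigma (nonisotropic_ball z dl) <= mu (nonisotropic_ball z dl))%E) ->
  {within @closed_unit_ball R d, continuous h} -> (forall z, 0 <= h z) ->
  (c%:E * \int[sigma]_(z in S) (h z)%:E <= \int[mu]_(z in S) (h z)%:E)%E.
Proof.
move=> c0 hQ ch h0.
have mS : measurable S := @sphere_borel R d.
have mK : measurable K := @ball_borel R d.
have mhK : measurable_fun K (h : B -> R) := within_ball_measurable ch.
have mhS : measurable_fun S (h : B -> R) := measurable_funS mK (@sub_sphere_ball R d) mhK.
have muS : mu S \is a fin_num.
  rewrite ge0_fin_numE ?measure_ge0//; apply: le_lt_trans fmu.
  by apply: le_measure; rewrite ?inE.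
suff key e : 0 < e -> (c%:E * \int[sigma]_(z in S) (h z)%:E <=
    \int[mu]_(z in S) (h z)%:E + e%:E * mu S)%E.
  apply/lee_addgt0Pr => e e0.
  have M0 : 0 < fine (mu S) + 1 by rewrite ltr_wpDl// fine_ge0// measure_ge0.
  apply: le_trans (key (e / (fine (mu S) + 1)) (divr_gt0 e0 M0)) _.
  apply: leeD2l; rewrite -(fineK muS) -EFinM lee_fin.
  by rewrite mulrAC ler_pdivrMr// ler_pM2l// lerDl.
move=> e0; have [dl dl0 hdl] := heine_cantor ch e0.
(* By [enormB_sphere], points in such a ball have squared distance at most [2 * dl2 = dl ^+ 2 / 2]
   from its center. *)
pose dl2 := dl ^+ 2 / 4.
have dl20 : 0 < dl2 by rewrite divr_gt0// exprn_gt0.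
have near z w : S z -> nonisotropic_ball z dl2 w -> h z <= h w + e.
  move=> z1 [w1 hw].
  have zw : enorm (z - w) < dl.
    rewrite -(@ltr_pXn2r _ 2)// ?nnegrE ?enorm_ge0 ?(ltW dl0)//.
    apply: le_lt_trans (enormB_sphere (sub_sphere_ball z1) w1) _.
    have d2 : 0 < dl ^+ 2 by rewrite exprn_gt0.
    apply: (@le_lt_trans _ _ (2 * dl2)); first by rewrite ler_pM2l.
    rewrite /dl2 mulrCA gtr_pMr// ltr_pdivrMr// mul1r ltr_nat//.
  have := hdl z w (sub_sphere_ball z1) (sub_sphere_ball w1) zw.
  by move/ltW; rewrite ler_norml => /andP[_]; rewrite lerBlDr addrC.
have [z0 z01] := sphere_nonempty.
have mQ z : measurable (nonisotropic_ball z dl2 : set B) := nonisotropic_borel z dl2.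
pose s := fine (sigma (nonisotropic_ball z0 dl2)).
have sE z : S z -> sigma (nonisotropic_ball z dl2) = s%:E.
  by move=> z1; rewrite (sigma_ball_eq hs dl2 z1 z01) /s fineK// (sigma_fin_num hs).
have s0 : 0 < s by rewrite -lte_fin -(sE _ z01); exact: sigma_ball_gt0.
pose E := [set p : B * B | S p.1 /\ nonisotropic_ball (p.1 : V) dl2 (p.2 : V)].
(* [h] is known to be measurable only on the closed ball; its extension by zero is measurable on the
   whole space, where the integrals are exchanged. *)
pose hh : B -> R := h \_ K.
have mhh : measurable_fun setT hh by apply/(measurable_restrictT _ _).1.
have hh0 z : 0 <= hh z by rewrite /hh patchE; case: ifP.
have hhS z : S z -> hh z = h z.
  by move=> /sub_sphere_ball z1; rewrite /hh patchE mem_set.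
pose G (p : B * B) : \bar R := (hh p.1 * \1_E p)%:E.
have mG : measurable_fun setT G.
  apply/measurable_EFinP; apply: measurable_funM.
    exact: (measurableT_comp mhh measurable_fst).
  by apply/measurable_indicP; exact: nonisotropic_borel2.
have G0 p : (0 <= G p)%E by rewrite lee_fin mulr_ge0.
have F1 z : S z -> (\int[mu]_w G (z, w) = (h z)%:E * mu (nonisotropic_ball z dl2))%E.
  move=> z1; rewrite -(integral_scale_indic mu (mQ z) (h0 z)).
  apply: eq_integral => w _; rewrite /G/= hhS//; congr (_ * _)%:E.
  rewrite !indicE; congr (_%:R); congr nat_of_bool; apply/idP/idP; rewrite !inE/=.
    by case.
  by move=> ?; split.
pose k : B -> R := fun w => (h w + e) * s.
have F2 w : (\int[sigma]_z G (z, w) <= ((k \_ S) w)%:E)%E.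
  rewrite patchE; case: ifPn => [|]; rewrite ?inE ?notin_setE => w1.
    have he : 0 <= h w + e by rewrite addr_ge0// ltW.
    rewrite /k EFinM -(sE w w1) -(integral_scale_indic sigma (mQ w) he).
    apply: ge0_le_integral => //.
    - exact: (measurableT_comp mG (pair2_measurable w)).
    - by apply/measurable_EFinP; apply: measurable_funM => //; apply/measurable_indicP.
    move=> z _; rewrite /G/= lee_fin !indicE.
    have [|] := boolP ((z, w) \in E); last by rewrite mulr0 mulr_ge0.
    rewrite inE => -[/= z1 zw]; rewrite hhS// mem_set ?mulr1; first exact: near.
    by apply: nonisotropic_ballC => //; exact: zw.1.
  rewrite integral0_eq// => z _; rewrite /G/= indicE memNset ?mulr0//.
  by move=> [_ [/w1]].
have mF : measurable_fun setT (fun z => \int[mu]_w G (z, w))%E.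
  exact: measurable_fubini_fin.
have cs : (0 < s%:E :> \bar R)%E by rewrite lte_fin.
rewrite -(@lee_pmul2l _ s%:E)// muleA -EFinM.
have sc0 : 0 <= s * c by rewrite mulr_ge0 ?ltW.
rewrite -(ge0_integralZ_real sigma mS mhS (fun z _ => h0 z) sc0).
apply: (@le_trans _ _ (\int[sigma]_(z in S) \int[mu]_w G (z, w))%E).
  apply: ge0_le_integral => //.
  - by move=> z _; rewrite lee_fin mulr_ge0.
  - by apply/measurable_EFinP; apply: measurable_funM.
  - exact: measurable_funTS.
  - move=> z z1; rewrite F1// EFinM muleC; apply: lee_wpmul2l; first by rewrite lee_fin.
    by rewrite mulrC EFinM -(sE z z1); exact: hQ.
apply: (@le_trans _ _ (\int[sigma]_z \int[mu]_w G (z, w))%E).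
  by apply: ge0_subset_integral => // z _; exact: integral_ge0.
rewrite (fubini_fin (sigma_fin hs) fmu mG G0).
apply: (@le_trans _ _ (\int[mu]_w ((k \_ S) w)%:E)%E).
  apply: ge0_le_integral => //.
  - by move=> w _; exact: integral_ge0.
  - have mG' : measurable_fun setT (fun p : B * B => G (p.2, p.1)).
      have msw : measurable_fun setT (fun p : B * B => (p.2, p.1)).
        by apply: measurable_fun_pair; [exact: measurable_snd|exact: measurable_fst].
      exact: (measurableT_comp mG msw).
    exact: (measurable_fubini_fin (sigma_fin hs) mG').
  - apply/measurable_EFinP; apply/(measurable_restrictT _ _).1 => //.
    by apply: measurable_funM => //; exact: measurable_funD.
have -> : (\int[mu]_w ((k \_ S) w)%:E = \int[mu]_(w in S) (k w)%:E)%E.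
  by rewrite [RHS]integral_mkcond; apply: eq_integral => w _; rewrite !patchE; case: ifP.
under eq_integral => w _ do rewrite /k mulrC.
rewrite (ge0_integralZ_real mu mS (f := fun w => h w + e)) ?(ltW s0)//; last 2 first.
- exact: measurable_funD.
- by move=> w _; rewrite addr_ge0// ltW.
under eq_integral => w _ do rewrite EFinD.
rewrite ge0_integralD//.
- by rewrite integral_cst.
- by move=> w _; rewrite lee_fin.
- exact/measurable_EFinP.
- by move=> w _; rewrite lee_fin ltW.
Qed.

End SphereDomination.

(** * The kernels *)

Section Kernel.
Variables (R : realType) (d' : nat).
Notation d := d'.+1.
Variables (sigma : {measure set BorelCd R d -> \bar R}).
Variables (p : R) (l' : nat).
Notation l := l'.+1.
Notation C := (CC R).
Notation V := (Cd R d).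
Notation B := (BorelCd R d).
Notation S := (@unit_sphere R d : set B).
Notation K := (@closed_unit_ball R d : set B).
Hypothesis hs : is_normalized_surface_measure sigma.
Hypothesis p0 : 0 < p.

(** The [p]-th power of the modulus of [k_w^l] is [|1 - <z, w>|] to the power [- kexp]. The
    condition [pl > 1] says that this exponent exceeds the dimension. *)
Definition kexp : R := (d * l)%N%:R * p.

Lemma kexp_gt0 : 0 < kexp.
Proof. by rewrite mulr_gt0// ltr0n. Qed.

(** The factor [t] collects the radii of both arguments: scaling either one by a real number only
    changes [t]. *)
Definition kden (t : R) (z w : V) : R := cabs (1 - Rc t * cinner z w) `^ (- kexp).

Lemma kden_ge0 t z w : 0 <= kden t z w.
Proof. exact: powR_ge0. Qed.

Lemma powRN_anti (a b q : R) : 0 <= q -> 0 < a -> a <= b -> b `^ (- q) <= a `^ (- q).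
Proof.
move=> q0 a0 ab; have b0 := lt_le_trans a0 ab.
rewrite !powRN lef_pV2 ?posrE ?powR_gt0//.
by apply: ge0_ler_powR => //; rewrite nnegrE ltW.
Qed.

Lemma kden_borel t : measurable_fun setT (fun x : B * B => kden t (x.1 : V) (x.2 : V)).
Proof. exact: (measurableT_comp (@measurable_powR R (- kexp)) (@kernel_den_borel R d t)). Qed.

Lemma kden_borel1 t (w : V) : measurable_fun setT (fun z : B => kden t (z : V) w).
Proof. exact: (measurableT_comp (kden_borel t) (pair2_measurable (w : B))). Qed.

Lemma kdenC t (z w : V) : kden t z w = kden t w z.
Proof.
rewrite /kden (cinnerC w z) -[cabs (1 - _ * cj _)]cabs_cj.
by rewrite cjD cjN cjM cjK cj1 cj_Rc.
Qed.

Lemma kdenZl t s (z w : V) : kden t (Rc s *: z) w = kden (t * s) z w.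
Proof. by rewrite /kden cinnerZl mulrA -RcM. Qed.

Lemma kdenZr t s (z w : V) : kden t z (Rc s *: w) = kden (t * s) z w.
Proof. by rewrite kdenC kdenZl kdenC. Qed.

Lemma kernel_pow (w z : V) : cabs (kernel_k w z ^+ l) `^ p = kden 1 z w.
Proof.
rewrite /kernel_k /kden Rc1 mul1r cabsX cabsV cabsX exprVn -exprM.
by rewrite -powR_invn ?cabs_ge0// -powRrM /kexp mulNr.
Qed.

Definition kpow (w : V) : \bar R := Hp_pow sigma p (fun u => kernel_k w u ^+ l).

Lemma kpow_ubound (w : V) (s : R) : 0 < s < 1 ->
  (\int[sigma]_(z in S) (kden s z w)%:E <= kpow w)%E.
Proof.
move=> s01; apply: ereal_sup_ubound; exists s; first by rewrite /= in_itv.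
by apply: eq_integral => z _; rewrite kernel_pow kdenZl mul1r.
Qed.

Lemma kpow_le (w : V) (M : \bar R) :
  (forall s, 0 < s < 1 -> (\int[sigma]_(z in S) (kden s z w)%:E <= M)%E) -> (kpow w <= M)%E.
Proof.
move=> H; apply: ge_ereal_sup => y [s /= s01 <-]; rewrite in_itv/= in s01.
apply: le_trans (H s s01); rewrite le_eqVlt; apply/orP; left; apply/eqP.
by apply: eq_integral => z _; rewrite kernel_pow kdenZl mul1r.
Qed.

Lemma kden_base_ge (t : R) (z w : V) : 0 <= t <= 1 -> enorm z <= 1 ->
  1 - enorm w <= cabs (1 - Rc t * cinner z w).
Proof.
move=> /andP[t0 t1] z1; rewrite -cinnerZl; apply: kernel_den_ge => //.
by rewrite enormZ cabs_Rc ger0_norm// mulr_ile1 ?enorm_ge0.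
Qed.

Lemma kden_base_le (t : R) (z w : V) : 0 <= t <= 1 -> enorm z <= 1 -> enorm w <= 1 ->
  cabs (1 - Rc t * cinner z w) <= 2.
Proof.
move=> /andP[t0 t1] z1 w1; apply: le_trans (cabsD _ _) _.
rewrite cabs1 cabsN cabsM cabs_Rc ger0_norm// (_ : 2 = 1 + 1)// lerD2l.
apply: mulr_ile1 => //; first exact: cabs_ge0.
by apply: le_trans (cauchy_schwarz _ _) _; apply: mulr_ile1; rewrite ?enorm_ge0.
Qed.

Lemma kden_bounds (t : R) (z w : V) : 0 <= t <= 1 -> enorm z <= 1 -> enorm w < 1 ->
  2 `^ (- kexp) <= kden t z w <= (1 - enorm w) `^ (- kexp).
Proof.
move=> t01 z1 w1; have k0 := ltW kexp_gt0.
have h := kden_base_ge w t01 z1; have h0 : 0 < 1 - enorm w by rewrite subr_gt0.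
by apply/andP; split; apply: powRN_anti => //; [exact: lt_le_trans h|exact: kden_base_le (ltW w1)].
Qed.

(** For [w] inside the ball the kernel lies between two positive constants. Hence [fine] in
    [Hp_norm] does not fall back to its default [0], and division by the norm is a true
    normalization. *)
Lemma kpow_fin (w : V) : enorm w < 1 -> exists2 n : R, 0 < n & kpow w = n%:E.
Proof.
move=> w1.
have bd s : 0 < s < 1 -> forall z, S z -> 2 `^ (- kexp) <= kden s z w <= (1 - enorm w) `^ (- kexp).
  move=> /andP[s0 s1] z z1; apply: kden_bounds => //; last by rewrite z1.
  by rewrite !ltW.
have mS : measurable S := @sphere_borel R d.
have up : (kpow w <= ((1 - enorm w) `^ (- kexp))%:E)%E.
  apply: kpow_le => s s01.
  have ub z : S z -> 0 <= kden s z w <= (1 - enorm w) `^ (- kexp).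
    by move=> z1; rewrite kden_ge0; case/andP: (bd s s01 z z1).
  by have /andP[] := sphere_integral_bound hs (measurable_funTS (kden_borel1 s w)) ub.
have lo : ((2 `^ (- kexp))%:E <= kpow w)%E.
  have h2 : 0 < (2^-1 : R) < 1 by rewrite invr_gt0 ltr0n invf_lt1// ltr1n.
  apply: le_trans (kpow_ubound w h2).
  have -> : ((2 `^ (- kexp))%:E = \int[sigma]_(z in S) (cst (2 `^ (- kexp))%:E) z)%E.
    by rewrite integral_cst// (sigmaS hs) mule1.
  apply: ge0_le_integral => //.
  - by move=> z _; rewrite lee_fin powR_ge0.
  - by apply/measurable_EFinP; apply: measurable_funTS; exact: kden_borel1.
  - by move=> z z1; rewrite lee_fin; case/andP: (bd _ h2 z z1).
have k2 : 0 < 2 `^ (- kexp) :> R by rewrite powR_gt0.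
case E : (kpow w) up lo => [n| |] //= up lo; exists n => //.
by rewrite -lte_fin; apply: lt_le_trans lo; rewrite lte_fin.
Qed.

Lemma kernel_K_pow (w z : V) (n : R) : 0 < n -> kpow w = n%:E ->
  cabs (kernel_K sigma p l w z) `^ p = n^-1 * kden 1 z w.
Proof.
move=> n0 E; rewrite /kernel_K cabsM powRM ?cabs_ge0// kernel_pow mulrC; congr (_ * _).
rewrite cabsV -[(Hp_norm _ _ _)%:C%C]/(Rc _) cabs_Rc /Hp_norm -/(kpow w) E/=.
rewrite ger0_norm ?powR_ge0// -powR_inv1 ?powR_ge0// -!powRrM.
by rewrite mulN1r mulrN mulVf ?lt0r_neq0// powR_inv1// ltW.
Qed.

Lemma differentiable_kernel_K (w z : V) : enorm w < 1 -> enorm z <= 1 ->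
  differentiable (kernel_K sigma p l w) z.
Proof.
move=> w1 z1.
have dc : differentiable (fun z : V => 1 - cinner z w) z.
  change (differentiable (cst 1 - (fun z : V => cinner z w)) z).
  apply: differentiableB; first exact: differentiable_cst.
  rewrite (_ : (fun z : V => cinner z w) = \sum_(k < d) (fun z : V => z ord0 k * cj (w ord0 k))); last first.
    by apply/funext => y; rewrite fct_sumE.
  apply: differentiable_sum => k.
  apply: (@differentiableM _ _ (fun z : V => z ord0 k) (cst (cj (w ord0 k)))).
    exact: differentiable_coord.
  exact: differentiable_cst.
have n0 : 1 - cinner z w != 0.
  rewrite -cabs_gt0; have := kernel_den_ge z1 (lexx (enorm w)).
  by apply: lt_le_trans; rewrite subr_gt0.
have dX (g : V -> C) n : differentiable g z -> differentiable (fun z => g z ^+ n.+1) z.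
  move=> dg; rewrite (_ : (fun z => _) = g ^+ n.+1); first exact: differentiableX.
  by rewrite exprfctE.
apply: (@differentiableM _ _ (fun z => kernel_k w z ^+ l) (cst _)); last exact: differentiable_cst.
apply: (dX (fun z => kernel_k w z)); apply: (@differentiableV _ _ (fun z : V => (1 - cinner z w) ^+ d)).
  exact: dX.
by rewrite expf_neq0.
Qed.

Lemma kernel_K_Hp (w : V) : enorm w < 1 ->
  [/\ {within @closed_unit_ball R d, continuous (kernel_K sigma p l w)},
   in_Hp sigma p (kernel_K sigma p l w) & (1 <= Hp_pow sigma p (kernel_K sigma p l w))%E].
Proof.
move=> w1; have [n n0 E] := kpow_fin w1.
have ninv : 0 <= n^-1 by rewrite invr_ge0 ltW.
have mS : measurable S := @sphere_borel R d.
have I s : (\int[sigma]_(z in S) (cabs (kernel_K sigma p l w (Rc s *: (z : V))) `^ p)%:E =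
   n^-1%:E * \int[sigma]_(z in S) (kden s z w)%:E)%E.
  rewrite -ge0_integralZ_real//.
  - by apply: eq_integral => z _; rewrite (kernel_K_pow _ n0 E) kdenZl mul1r.
  - by apply: measurable_funTS; exact: kden_borel1.
  - by move=> z _; exact: kden_ge0.
split.
- apply/continuous_in_subspaceT => z; rewrite inE => z1.
  exact/differentiable_continuous/differentiable_kernel_K.
- split; first by move=> z z1; apply: differentiable_kernel_K => //; exact: ltW.
  apply: (@le_lt_trans _ _ 1%E); last by rewrite ltry.
  apply: ge_ereal_sup => y [s /= s01 <-]; rewrite in_itv/= in s01.
  rewrite I; have := kpow_ubound w s01; rewrite E => h.
  apply: le_trans (lee_wpmul2l _ h) _; first by rewrite lee_fin.
  by rewrite -EFinM mulVf ?lt0r_neq0.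
- have nE : (0 < n^-1%:E :> \bar R)%E by rewrite lte_fin invr_gt0.
  suff : (kpow w <= n%:E * Hp_pow sigma p (kernel_K sigma p l w))%E.
    rewrite E => h; rewrite -(@lee_pmul2l _ n%:E)// ?mule1//.
  apply: kpow_le => s s01.
  have -> : (\int[sigma]_(z in S) (kden s z w)%:E = n%:E * (n^-1%:E * \int[sigma]_(z in S) (kden s z w)%:E))%E.
    by rewrite muleA -EFinM mulfV ?lt0r_neq0// mul1e.
  rewrite -I; apply: lee_wpmul2l; first by rewrite lee_fin ltW.
  by apply: ereal_sup_ubound; exists s => //; rewrite /= in_itv.
Qed.

Lemma kden_integral_eq (t : R) (z w : V) : S z -> S w ->
  (\int[sigma]_(x in S) (kden t x z)%:E = \int[sigma]_(x in S) (kden t x w)%:E)%E.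
Proof.
move=> z1 w1; have [U hU zU] := unitary_transitive z1 w1.
rewrite -(integral_sphereU hs hU (f := fun x : B => (kden t (x : V) w)%:E)).
- by apply: eq_integral => x _; rewrite -zU /kden cinnerU.
- by apply/measurable_EFinP; apply: measurable_funTS; exact: kden_borel1.
- by move=> x _; rewrite lee_fin kden_ge0.
Qed.

Lemma kpow_radial_le (r : R) (z w : V) : S z -> S w -> (kpow (Rc r *: z) <= kpow (Rc r *: w))%E.
Proof.
move=> z1 w1; apply: kpow_le => s s01; apply: le_trans (kpow_ubound _ s01).
under eq_integral do rewrite kdenZr.
under [leRHS]eq_integral do rewrite kdenZr.
by rewrite (kden_integral_eq _ z1 w1).
Qed.

Lemma kpow_radial (r : R) (z w : V) : S z -> S w -> kpow (Rc r *: z) = kpow (Rc r *: w).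
Proof. by move=> z1 w1; apply: le_anti; apply/andP; split; exact: kpow_radial_le. Qed.

Lemma kden_base_ge_sphere (t r : R) (y x : V) : 0 <= t <= 1 -> 0 < r -> S y -> S x ->
  1 - r <= cabs (1 - Rc (t * r) * cinner y x).
Proof.
move=> t01 r0 y1 x1.
have y1' : enorm y <= 1 by rewrite y1.
have := kden_base_ge (Rc r *: x) t01 y1'.
by rewrite enormZ x1 mulr1 cabs_Rc gtr0_norm// cinnerZr cj_Rc mulrA -RcM.
Qed.

(* Moving the radius [t] of [z] to some [s] in the open interval [0, 1] at distance at
   most [1 - r] changes the kernel by a bounded factor only. *)
Lemma kden_integral_le (r : R) (z w : V) (n : R) : 0 < r < 1 -> K z -> S w ->
  kpow (Rc r *: w) = n%:E ->
  (\int[sigma]_(x in S) (kden r z x)%:E <= (2 `^ kexp * n)%:E)%E.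
Proof.
move=> /andP[r0 r1] z1 w1 E; have mS : measurable S := @sphere_borel R d.
have k0 := ltW kexp_gt0.
pose t := enorm z.
have t0 : 0 <= t := enorm_ge0 z.
have t1 : t <= 1 := z1.
have [y y1 zy] : exists2 y : V, S y & z = Rc t *: y.
  have [z0|z0] := eqVneq t 0.
    by exists w => //; rewrite z0 scale0r; apply: enorm_eq0.
  exists (Rc t^-1 *: z); last by rewrite scalerA -RcM divff// scale1r.
  by rewrite /unit_sphere/= enormZ cabs_Rc ger0_norm ?invr_ge0// mulVf.
pose s := t + (2^-1 - t) * (1 - r).
have s01 : 0 < s < 1 by rewrite /s; apply/andP; split; nra.
have st : `|s - t| <= 1 - r by rewrite /s ler_norml; apply/andP; split; nra.
have pt x : S x -> kden r z x <= 2 `^ kexp * kden (s * r) y x.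
  move=> x1; rewrite zy kdenZl /kden.
  set A := cabs (1 - Rc (r * t) * _); set D := cabs _.
  have a1 : cabs (cinner y x) <= 1.
    by apply: le_trans (cauchy_schwarz _ _) _; rewrite y1 x1 mul1r.
  have A1 : 1 - r <= A.
    by rewrite /A (mulrC r); apply: kden_base_ge_sphere => //; rewrite t0 t1.
  (* The denominators differ by at most [r * |s - t|], hence by at most [1 - r], and [A] is at least
     [1 - r]. This is the origin of the factor [2] to the power [kexp]. *)
  have DA : D <= 2 * A.
    have -> : D = cabs ((1 - Rc (r * t) * cinner y x) + Rc (r * (t - s)) * cinner y x).
      have e : r * (t - s) = r * t - s * r by ring.
      by rewrite /D e RcD RcN; congr cabs; ring.
    apply: le_trans (cabsD _ _) _; rewrite -/A cabsM cabs_Rc normrM (gtr0_norm r0) distrC.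
    have : r * `|s - t| * cabs (cinner y x) <= 1 * (1 - r) * 1.
      by apply: ler_pM => //; rewrite ?mulr_ge0 ?cabs_ge0 ?(ltW r0)//; apply: ler_pM => //; exact: ltW.
    lra.
  have A0 : 0 < A by lra.
  have sr : 0 <= s * r <= 1 by case/andP: s01 => ? ?; rewrite mulr_ge0 ?mulr_ile1 ?ltW.
  have D0 : 0 < D.
    apply: lt_le_trans (kden_base_ge_sphere (t := s) _ r0 y1 x1); first by rewrite subr_gt0.
    by case/andP: s01 => ? ?; rewrite !ltW.
  have -> : 2 `^ kexp * D `^ (- kexp) = (D / 2) `^ (- kexp).
    rewrite powRM ?(ltW D0)// mulrC; congr (_ * _).
    by rewrite -powR_inv1// -powRrM mulrN mulN1r opprK.
  by apply: powRN_anti => //; [rewrite divr_gt0|rewrite ler_pdivrMr// mulrC].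
have mk t' (v : V) : measurable_fun S (fun x : B => kden t' v (x : V)).
  apply: measurable_funTS; rewrite (_ : (fun x : B => _) = (fun x : B => kden t' (x : V) v)).
    exact: kden_borel1.
  by apply/funext => x; rewrite kdenC.
apply: (@le_trans _ _ (\int[sigma]_(x in S) (2 `^ kexp * kden (s * r) y x)%:E)%E).
  apply: ge0_le_integral => //.
  - by move=> x _; rewrite lee_fin kden_ge0.
  - by apply/measurable_EFinP; exact: mk.
  - by apply/measurable_EFinP; apply: measurable_funM => //; exact: mk.
rewrite (ge0_integralZ_real sigma mS (mk _ _) (fun x _ => kden_ge0 _ _ _)) ?powR_ge0//.
rewrite EFinM -E; apply: lee_wpmul2l; first by rewrite lee_fin powR_ge0.
apply: le_trans (kpow_ubound (Rc r *: w) s01).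
under [leRHS]eq_integral do rewrite kdenZr.
rewrite -(kden_integral_eq _ y1 w1) le_eqVlt; apply/orP; left; apply/eqP.
by apply: eq_integral => x _; rewrite kdenC.
Qed.

End Kernel.

(** * Concentration of the kernels *)

Section Necessity.
Variables (R : realType) (d' : nat).
Notation d := d'.+1.
Variables (sigma mu : {measure set BorelCd R d -> \bar R}).
Variables (p : R) (l' : nat).
Notation l := l'.+1.
Notation C := (CC R).
Notation V := (Cd R d).
Notation B := (BorelCd R d).
Notation S := (@unit_sphere R d : set B).
Notation K := (@closed_unit_ball R d : set B).
Notation q := (kexp d' p l').
Notation kpow := (kpow sigma p l').
Hypothesis hs : is_normalized_surface_measure sigma.
Hypothesis fmu : (mu setT < +oo)%E.
Hypothesis p0 : 0 < p.
Hypothesis pl : 1 < p * l%:R.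

(** The square matches the order of [cover_radius], so that [1 - radius m] is at most the radius of
    the covering balls; [m.+2] keeps the value positive at [m = 0]. *)
Definition radius (m : nat) : R := 1 - (m.+2%:R ^+ 2)^-1.

Lemma radius01 m : 0 < radius m < 1.
Proof.
have m2 : 1 < m.+2%:R ^+ 2 :> R by rewrite exprn_egt1// ltr1n.
have m0 : 0 < m.+2%:R ^+ 2 :> R by apply: lt_trans m2.
by rewrite subr_gt0 invf_lt1// m2/= ltrBlDr ltrDl invr_gt0.
Qed.

Lemma radius_ge m : 1 - radius m <= (m.+1%:R ^+ 2)^-1.
Proof.
rewrite /radius opprB addrCA subrr addr0 lef_pV2 ?posrE ?exprn_gt0 ?ltr0n//.
by rewrite ler_pXn2r ?nnegrE ?ler0n// ler_nat.
Qed.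

Lemma radius_cvg (e : R) : 0 < e -> exists m0, forall m, (m0 <= m)%N -> 1 - radius m <= e.
Proof.
move=> e0; have q0 : 0 <= e^-1 by rewrite invr_ge0 ltW.
exists (Num.truncn e^-1) => m m0m; apply: le_trans (radius_ge m) _.
rewrite -[leRHS]invrK lef_pV2 ?posrE ?exprn_gt0 ?invr_gt0 ?ltr0n//.
have /andP[_ h] := truncn_itv q0; apply: le_trans (ltW h) _.
apply: (@le_trans _ _ m.+1%:R); first by rewrite ler_nat ltnS.
by rewrite expr2 ler_peMl// ?ler0n// ler1n.
Qed.

Let kappa : R := 4 * pi + 4 * d%:R.
Let cc : R := (d * 9 ^ d')%N%:R.

Let kappa1 : 1 <= kappa.
Proof.
have pi0 := @pi_ge2 R; have : 0 <= 4 * d%:R :> R by rewrite mulr_ge0.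
by rewrite /kappa; lra.
Qed.

Let cc0 : 0 < cc.
Proof. by rewrite ltr0n muln_gt0 expn_gt0. Qed.

(** On the ball of radius [dl] around [z0] the denominator is at most [dl + (1 - r * r)], hence at
    most [3 * dl], because [1 - r <= dl]. So the integral is at least [(3 * dl)^(-q)] times the
    measure of the ball. The product [r * r] arises from taking [r] also as the radius in the
    supremum. *)
Lemma kpow_lower (z0 : V) (m : nat) (n : R) : S z0 -> kpow (Rc (radius m) *: z0) = n%:E ->
  (3 * kappa) `^ (- q) / cc * (m.+1%:R ^+ 2) `^ (q - d%:R) <= n.
Proof.
move=> z01 E; have r01 := radius01 m; have /andP[r0 r1] := r01.
set r := radius m in E r01 r0 r1 *.
have m0 : 0 < m.+1%:R ^+ 2 :> R by rewrite exprn_gt0// ltr0n.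
have k0 : 0 < kappa by apply: lt_le_trans kappa1.
have q0 : 0 < q by exact: kexp_gt0.
pose dl : R := cover_radius R d' m.
have dl0 : 0 < dl by rewrite /dl /cover_radius divr_gt0.
have mS : measurable S := @sphere_borel R d.
have mQ : measurable (nonisotropic_ball z0 dl : set B) := nonisotropic_borel z0 dl.
have rdl : 1 - r <= dl.
  by apply: le_trans (radius_ge m) _; rewrite /dl /cover_radius -/kappa ler_peMl// invr_ge0 ltW.
have pt x : nonisotropic_ball z0 dl x -> (3 * dl) `^ (- q) <= kden p l' (r * r) x z0.
  move=> [x1 hx].
  have a1 : cabs (cinner x z0) <= 1.
    by apply: le_trans (cauchy_schwarz _ _) _; rewrite x1 z01 mul1r.
  have ha : cabs (1 - cinner x z0) <= dl.
    by rewrite -cabs_cj cjD cjN cj1 -cinnerC.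
  have rr : 0 <= 1 - r * r by rewrite subr_ge0 mulr_ile1 ?ltW.
  apply: powRN_anti; first exact: ltW.
    apply: lt_le_trans (kden_base_ge_sphere (t := r) _ r0 x1 z01); first by rewrite subr_gt0.
    by rewrite !ltW.
  have -> : 1 - Rc (r * r) * cinner x z0 = (1 - cinner x z0) + Rc (1 - r * r) * cinner x z0.
    by rewrite RcD RcN Rc1; ring.
  apply: le_trans (cabsD _ _) _; rewrite cabsM cabs_Rc ger0_norm//.
  have : (1 - r * r) * cabs (cinner x z0) <= (1 - r * r) * 1 by rewrite ler_wpM2l.
  nra.
have sig := sigma_ball_ge hs m z01.
rewrite -lee_fin -E; apply: le_trans (kpow_ubound sigma p l' _ r01).
under [leRHS]eq_integral do rewrite kdenZr.
have mk : measurable_fun setT (fun x : B => kden p l' (r * r) (x : V) z0) by exact: kden_borel1.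
apply: (@le_trans _ _ (\int[sigma]_(x in nonisotropic_ball z0 dl) (kden p l' (r * r) x z0)%:E)%E); last first.
  apply: ge0_subset_integral => //.
  - by apply/measurable_EFinP; exact: measurable_funTS.
  - by move=> x _; rewrite lee_fin kden_ge0.
  - by move=> x [].
apply: (@le_trans _ _ (\int[sigma]_(x in nonisotropic_ball z0 dl) (cst ((3 * dl) `^ (- q))%:E) x)%E); last first.
  apply: ge0_le_integral => //.
  - by move=> x _; rewrite lee_fin powR_ge0.
  - by apply/measurable_EFinP; exact: measurable_funTS.
rewrite integral_cst//.
apply: le_trans (lee_wpmul2l _ sig); last by rewrite lee_fin powR_ge0.
rewrite -EFinM lee_fin le_eqVlt; apply/orP; left; apply/eqP.
rewrite /dl /cover_radius -/kappa -/cc.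
have e1 : (3 * (kappa / m.+1%:R ^+ 2)) `^ (- q) = (3 * kappa) `^ (- q) * (m.+1%:R ^+ 2) `^ q.
  rewrite mulrA powRM ?mulr_ge0 ?(ltW k0) ?invr_ge0 ?(ltW m0)//; congr (_ * _).
  by rewrite -powR_inv1 ?(ltW m0)// -powRrM mulN1r opprK.
have e2 : (m.+1%:R ^+ 2) `^ (q - d%:R) = (m.+1%:R ^+ 2) `^ q / m.+1%:R ^+ (2 * d).
  by rewrite powRB ?(lt0r_neq0 m0) ?implybT// powR_mulrn ?(ltW m0)// exprM.
by rewrite e1 e2 invfM; ring.
Qed.

Lemma kpow_infty (z0 : V) (Y : R) : S z0 -> exists m0, forall m n, (m0 <= m)%N ->
  kpow (Rc (radius m) *: z0) = n%:E -> Y <= n.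
Proof.
move=> z01; have k0 : 0 < kappa by apply: lt_le_trans kappa1.
pose c := (3 * kappa) `^ (- q) / cc.
have c0 : 0 < c by rewrite divr_gt0// powR_gt0 ?mulr_gt0.
pose a := q - d%:R.
(* Here [a] is [d * (p * l - 1)]. *)
have a0 : 0 < a.
  by rewrite subr_gt0 /kexp natrM -mulrA ltr_pMr ?ltr0n// mulrC.
pose Z := Num.max 1 (Y / c).
have Z1 : 1 <= Z by rewrite le_max lexx.
have Z0 : 0 <= Z by exact: le_trans Z1.
have ZY : Y / c <= Z by rewrite le_max lexx orbT.
have q0 : 0 <= Z `^ a^-1 by exact: powR_ge0.
exists (Num.truncn (Z `^ a^-1)) => m n mm E.
apply: le_trans (kpow_lower z01 E); rewrite -/c -/a mulrC -ler_pdivrMr//.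
have ZE : Z = (Z `^ a^-1) `^ a by rewrite -powRrM mulVf ?lt0r_neq0// powRr1.
apply: le_trans ZY _; rewrite [leLHS]ZE.
apply: ge0_ler_powR; rewrite ?nnegrE ?powR_ge0 ?exprn_ge0 ?ler0n ?(ltW a0)//.
have /andP[_ h] := truncn_itv q0; apply: le_trans (ltW h) _.
apply: (@le_trans _ _ m.+1%:R); first by rewrite ler_nat ltnS.
by rewrite expr2 ler_peMl// ?ler0n// ler1n.
Qed.

(** An interior [z] has denominators at least [1 - |z|]. If [z] is on the sphere, let [e] be the
    excess of [|1 - <z0, z>|] over [dl]. Cauchy-Schwarz keeps [z] at distance at least [e] from the
    ball, a radius with [1 - radius m <= e / 2] loses at most half of it, and [enormB_sphere] turns
    the distance [e / 2] into the bound [e ^+ 2 / 8]. *)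
Lemma kden_base_away (z0 z : V) (dl : R) : S z0 -> K z -> ~ nonisotropic_ball z0 dl z ->
  exists2 b : R, 0 < b & exists m0, forall m, (m0 <= m)%N ->
    forall x, nonisotropic_ball z0 dl x -> b <= cabs (1 - Rc (radius m) * cinner z x).
Proof.
move=> z01 zK nQ; have [z1|z1] := ltP (enorm z) 1.
  exists (1 - enorm z); first by rewrite subr_gt0.
  exists 0%N => m _ x [x1 _]; have /andP[r0 r1] := radius01 m.
  rewrite -cabs_cj cjD cjN cjM cj1 cj_Rc -cinnerC.
  by apply: kden_base_ge; rewrite ?x1// !ltW.
have z1' : S z by apply: le_anti; rewrite z1 andbT; exact: zK.
have hz : dl < cabs (1 - cinner z0 z) by rewrite ltNge; apply/negP => h; apply: nQ.
pose e := cabs (1 - cinner z0 z) - dl.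
have e0 : 0 < e by rewrite subr_gt0.
have e2 : 0 < e / 2 by rewrite divr_gt0.
exists (e ^+ 2 / 8); first by rewrite divr_gt0// exprn_gt0.
have [m0 hm0] := radius_cvg e2; exists m0 => m /hm0 rm x [x1 hx].
have /andP[r0 r1] := radius01 m; set r := radius m in rm r0 r1 *.
have d1 : e <= enorm (z - x).
  have h1 : cabs (cinner z0 (z - x)) <= enorm (z - x).
    by have := cauchy_schwarz z0 (z - x); rewrite z01 mul1r.
  apply: le_trans h1.
  have e1 : 1 - cinner z0 z = (1 - cinner z0 x) - cinner z0 (z - x).
    by rewrite cinnerDr cinnerNr; ring.
  have h2 := cabsD (1 - cinner z0 x) (- cinner z0 (z - x)).
  rewrite -e1 cabsN in h2.
  by rewrite /e lerBlDl; apply: le_trans h2 _; rewrite lerD2r.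
have d2 : e / 2 <= enorm (Rc r *: z - x).
  have h1 : enorm (z - x) <= enorm (z - Rc r *: z) + enorm (Rc r *: z - x).
    by rewrite -[z - x](subrKA (Rc r *: z)); exact: enormD.
  have h2 : enorm (z - Rc r *: z) <= 1 - r.
    rewrite -{1}[z]scale1r -scalerBl enormZ z1' mulr1 -Rc1 -RcN -RcD cabs_Rc.
    by rewrite ger0_norm// subr_ge0 ltW.
  lra.
have rz : enorm (Rc r *: z) <= 1 by rewrite enormZ z1' mulr1 cabs_Rc gtr0_norm// ltW.
have := enormB_sphere rz x1; rewrite cinnerZl => h.
have h3 : (e / 2) ^+ 2 <= enorm (Rc r *: z - x) ^+ 2.
  by rewrite ler_pXn2r ?nnegrE ?enorm_ge0 ?(ltW e2).
have h4 := le_trans h3 h; rewrite -(@ler_pM2l _ 2)//; apply: le_trans h4.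
by rewrite le_eqVlt; apply/orP; left; apply/eqP; field.
Qed.

Lemma ball_domination (c : R) (z0 : V) (dl : R) : 0 < c -> S z0 -> 0 < dl ->
  (forall w : V, unit_ball w ->
    (c%:E <= \int[mu]_(z in K) (cabs (kernel_K sigma p l w z) `^ p)%:E)%E) ->
  (c%:E * sigma (nonisotropic_ball z0 dl) <=
    (2 `^ q)%:E * mu (nonisotropic_ball z0 dl))%E.
Proof.
move=> c0 z01 dl0 hc.
pose Q : set B := nonisotropic_ball z0 dl.
have mQ : measurable Q := nonisotropic_borel z0 dl.
have mK : measurable K := @ball_borel R d.
have mS : measurable S := @sphere_borel R d.
have QS x : Q x -> S x by case.
have SK := @sub_sphere_ball R d.
have rad1 m (z : V) : S z -> enorm (Rc (radius m) *: z) < 1.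
  move=> z1; have /andP[r0 r1] := radius01 m.
  by rewrite enormZ z1 mulr1 cabs_Rc gtr0_norm.
(* By [kpow_radial] this one number normalizes the kernel for every pole [Rc (radius m) *: x] with
   [x] on the sphere. *)
pose n m := fine (kpow (Rc (radius m) *: z0)).
have nE m : 0 < n m /\ kpow (Rc (radius m) *: z0) = (n m)%:E.
  by have [k k0 E] := kpow_fin l' hs p0 (rad1 m z0 z01); rewrite /n E.
(* The indicators turn both integrals into integrals over the whole space, so that they can be
   exchanged. *)
pose g m (y : B * B) : R := \1_K y.1 * \1_Q y.2 * ((n m)^-1 * kden p l' (radius m) (y.1 : V) (y.2 : V)).
have g0 m y : 0 <= g m y.
  by rewrite /g !mulr_ge0 ?kden_ge0// invr_ge0 ltW//; case: (nE m).
have mg m : measurable_fun setT (fun y => (g m y)%:E).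
  apply/measurable_EFinP; apply: measurable_funM; first apply: measurable_funM.
  - by apply: (measurableT_comp _ measurable_fst); apply/measurable_indicP.
  - by apply: (measurableT_comp _ measurable_snd); apply/measurable_indicP.
  - by apply: measurable_funM => //; exact: kden_borel.
pose F m (z : B) : \bar R := (\int[sigma]_x (g m (z, x))%:E)%E.
have mF m : measurable_fun setT (F m).
  by apply: (measurable_fubini_fin (sigma_fin hs) (mg m)) => y; rewrite lee_fin.
have F0 m z : (0 <= F m z)%E by apply: integral_ge0 => x _; rewrite lee_fin.
have FQ m z : K z -> F m z = (\int[sigma]_(x in Q) ((n m)^-1 * kden p l' (radius m) z x)%:E)%E.
  move=> zK; rewrite [RHS]integral_mkcond; apply: eq_integral => x _.
  rewrite /g/= patchE !indicE (mem_set zK) mul1r.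
  by case: (x \in Q); rewrite ?mul1r ?mul0r.
have FnK m z : ~ K z -> F m z = 0%E.
  move=> zK; apply: integral0_eq => x _.
  by rewrite /g/= indicE (memNset zK) !mul0r.
have kmeas m (z : V) : measurable_fun setT (fun x : B => (n m)^-1 * kden p l' (radius m) z (x : V)).
  apply: measurable_funM => //.
  by apply: (measurableT_comp (kden_borel p l' (radius m)) (pair1_measurable (z : B))).
have Fle m z : (F m z <= (2 `^ q)%:E)%E.
  have [zK|zK] := pselect (K z); last by rewrite FnK// lee_fin powR_ge0.
  have [nm0 nmE] := nE m.
  have ninv : 0 <= (n m)^-1 by rewrite invr_ge0 ltW.
  rewrite FQ//; apply: (@le_trans _ _ (\int[sigma]_(x in S) ((n m)^-1 * kden p l' (radius m) z x)%:E)%E).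
    apply: ge0_subset_integral => //.
    - by apply/measurable_EFinP; exact: measurable_funTS.
    - by move=> x _; rewrite lee_fin mulr_ge0// kden_ge0.
  rewrite ge0_integralZ_real//; last 2 first.
  - apply: measurable_funTS.
    by apply: (measurableT_comp (kden_borel p l' (radius m)) (pair1_measurable (z : B))).
  - by move=> x _; exact: kden_ge0.
  have h := kden_integral_le hs p0 (radius01 m) zK z01 nmE.
  apply: le_trans (lee_wpmul2l _ h) _; first by rewrite lee_fin.
  by rewrite -EFinM lee_fin mulrCA mulVf ?mulr1// lt0r_neq0.
(* Hypothesis [hc] bounds from below the integral over [z] for each [x] in [Q]. After the exchange
   the domain of [z] is split at [Q], where [Fle] applies. *)
have step m : (c%:E * sigma Q <= (2 `^ q)%:E * mu Q + \int[mu]_(z in ~` Q) F m z)%E.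
  have [nm0 nmE] := nE m.
  have mG : measurable_fun setT (fun x => \int[mu]_z (g m (z, x))%:E)%E.
    have msw : measurable_fun setT (fun y : B * B => (y.2, y.1)).
      by apply: measurable_fun_pair; [exact: measurable_snd|exact: measurable_fst].
    have := measurable_fubini_fin fmu (measurableT_comp (mg m) msw).
    by apply => y; rewrite lee_fin.
  apply: (@le_trans _ _ (\int[mu]_z F m z)%E).
    have -> : (\int[mu]_z F m z = \int[sigma]_x \int[mu]_z (g m (z, x))%:E)%E.
      by apply: (fubini_fin fmu (sigma_fin hs) (mg m)) => y; rewrite lee_fin.
    apply: (@le_trans _ _ (\int[sigma]_(x in Q) \int[mu]_z (g m (z, x))%:E)%E); last first.
      apply: ge0_subset_integral => // x _.
      by apply: integral_ge0 => z _; rewrite lee_fin.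
    rewrite -integral_cst//; apply: ge0_le_integral => //.
    - by move=> x _; rewrite lee_fin ltW.
    - exact: measurable_funTS.
    - move=> x xQ; have x1 := QS _ xQ.
      apply: le_trans (hc (Rc (radius m) *: x) (rad1 m x x1)) _.
      rewrite [leLHS]integral_mkcond le_eqVlt; apply/orP; left; apply/eqP.
      apply: eq_integral => z _.
      have E2 : kpow (Rc (radius m) *: x) = (n m)%:E.
        by rewrite (kpow_radial p l' hs (radius m) x1 z01).
      rewrite /g/= patchE !indicE (mem_set xQ) mulr1.
      case: (z \in K); rewrite ?mul1r ?mul0r//.
      by rewrite (kernel_K_pow p0 z nm0 E2) kdenZr mul1r.
  rewrite -(setvU Q) ge0_integral_setU//=; last 3 first.
  - exact: measurableC.
  - rewrite setvU; exact: mF.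
  - exact/disj_setPLR.
  rewrite addeC; apply: leeD2r.
  have <- : (\int[mu]_(z in Q) (cst (2 `^ q)%:E) z = (2 `^ q)%:E * mu Q)%E by exact: integral_cst.
  apply: ge0_le_integral.
  - exact: mQ.
  - by move=> z _; exact: F0.
  - exact: measurable_funTS (mF m).
  - exact: measurable_cst.
  - by move=> z _; exact: Fle.
(* Away from [Q] the denominators are bounded below by some [b] while [n m] tends to infinity. The
   constant of [Fle] dominates, and it is integrable because [mu] is finite. *)
have lim0 : ((\int[mu]_(z in ~` Q) F m z)%E @[m --> \oo] --> 0%E).
  have mCQ : measurable (~` Q) by exact: measurableC.
  have pt z : (~` Q) z -> F m z @[m --> \oo] --> 0%E.
    move=> nQ; have [zK|zK] := pselect (K z); last first.
      by under eq_fun do rewrite FnK//; exact: cvg_cst.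
    have [b b0 [m0 hb]] := kden_base_away z01 zK nQ.
    have bq0 : 0 <= b `^ (- q) by exact: powR_ge0.
    have up m : (m0 <= m)%N -> (F m z <= ((n m)^-1 * b `^ (- q))%:E)%E.
      move=> mm; have [nm0 nmE] := nE m.
      have ninv : 0 <= (n m)^-1 by rewrite invr_ge0 ltW.
      rewrite FQ//; apply: (@le_trans _ _ (\int[sigma]_(x in Q) (cst ((n m)^-1 * b `^ (- q))%:E) x)%E).
        apply: ge0_le_integral => //.
        - by move=> x _; rewrite lee_fin mulr_ge0// kden_ge0.
        - by apply/measurable_EFinP; exact: measurable_funTS.
        - move=> x xQ; rewrite lee_fin ler_wpM2l//.
          by apply: powRN_anti => //; [exact: ltW (kexp_gt0 _ _ p0)|exact: hb].
      rewrite integral_cst// -[leRHS]mule1; apply: lee_wpmul2l; first by rewrite lee_fin mulr_ge0.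
      exact: sigma_le1.
    apply/fine_cvgP; split.
      near=> m; rewrite ge0_fin_numE//; apply: le_lt_trans (Fle m z) _; exact: ltry.
    apply/cvgrPdist_le => e e0.
    have [m1 hm1] := kpow_infty (b `^ (- q) / e) z01.
    near=> m.
    have mm0 : (m0 <= m)%N by near: m; exists m0.
    have mm1 : (m1 <= m)%N by near: m; exists m1.
    have [nm0 nmE] := nE m.
    rewrite /= sub0r normrN ger0_norm ?fine_ge0//.
    have h1 := up m mm0.
    have h2 : fine (F m z) <= (n m)^-1 * b `^ (- q).
      rewrite -lee_fin fineK// ge0_fin_numE//; exact: le_lt_trans h1 (ltry _).
    apply: le_trans h2 _; rewrite mulrC ler_pdivrMr//.
    by have := hm1 m (n m) mm1 nmE; rewrite ler_pdivrMr// mulrC.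
  have muC : (mu (~` Q) < +oo)%E.
    by apply: le_lt_trans fmu; apply: le_measure; rewrite ?inE.
  have := @dominated_convergence _ _ _ mu (~` Q) mCQ F (cst 0%E) (cst (2 `^ q)%:E).
  case.
  - by move=> m; exact: measurable_funTS.
  - exact: measurable_cst.
  - by apply: aeW => z hz; exact: pt.
  - apply/integrableP; split; first exact: measurable_cst.
    rewrite /= integral_cst// lte_mul_pinfty ?lee_fin//.
  - by apply: aeW => z m _; rewrite gee0_abs.
  by move=> _ _; rewrite integral0.
apply/lee_addgt0Pr => e e0.
have /fine_cvgP[fn /cvgrPdist_lt/(_ e e0) near0] := lim0.
have : \forall m \near \oo, (c%:E * sigma Q <= (2 `^ q)%:E * mu Q + e%:E)%E.
  near=> m; apply: le_trans (step m) _; apply: leeD2l.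
  have fm : (\int[mu]_(z in ~` Q) F m z)%E \is a fin_num by near: m.
  have : `|0 - fine (\int[mu]_(z in ~` Q) F m z)%E| < e by near: m.
  rewrite sub0r normrN -[leLHS](fineK fm) lee_fin => h.
  exact: le_trans (ler_norm _) (ltW h).
by case=> m0 _ /(_ m0 (leqnn _)).
Unshelve. all: by end_near. Qed.

End Necessity.

Theorem theorem7p1 (R : realType) (d : nat) (p : R) (l : nat)
    (sigma : {measure set BorelCd R d -> \bar R})
    (mu : {finite_measure set BorelCd R d -> \bar R}) :
  (0 < d)%N -> 0 < p -> (0 < l)%N -> 1 < p * l%:R ->
  is_normalized_surface_measure sigma ->
  mu (~` (@closed_unit_ball R d : set (BorelCd R d))) = 0%E ->
  [<->
    (* (i) *)
    (exists C : R, 0 < C /\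
      forall f : Cd R d -> CC R,
        {within @closed_unit_ball R d, continuous f} -> in_Hp sigma p f ->
        (C%:E * Hp_pow sigma p f <=
          \int[mu]_(z in (@closed_unit_ball R d : set (BorelCd R d)))
             ((cabs (f z)) `^ p)%:E)%E);
    (* (ii) *)
    (exists C : R, 0 < C /\
      forall w : Cd R d, unit_ball w ->
        (C%:E <=
          \int[mu]_(z in (@closed_unit_ball R d : set (BorelCd R d)))
             ((cabs (kernel_K sigma p l w z)) `^ p)%:E)%E);
    (* (iii) *)
    (exists C : R, 0 < C /\
      forall (zeta : Cd R d) (delta : R), unit_sphere zeta -> 0 < delta ->
        (C%:E * sigma (nonisotropic_ball zeta delta)
           <= mu (nonisotropic_ball zeta delta))%E)].
Proof.
case: d sigma mu => // d' sigma mu _ p0; case: l => // l' _ pl hs _.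
have fmu : (mu setT < +oo)%E by rewrite -ge0_fin_numE ?measure_ge0// fin_num_measure.
tfae.
- move=> [c [c0 hc]]; exists c; split => // w w1.
  have [cK hK one] := kernel_K_Hp l' hs p0 w1.
  apply: le_trans (hc _ cK hK); rewrite -[leLHS]mule1.
  by apply: lee_wpmul2l => //; rewrite lee_fin ltW.
(* The loss is the factor from [kden_integral_le], which depends neither on the center nor on the
   radius of the ball. *)
- move=> [c [c0 hc]]; exists (c / 2 `^ kexp d' p l').
  have k0 : 0 < 2 `^ kexp d' p l' by rewrite powR_gt0.
  split; first by rewrite divr_gt0.
  move=> z dl z1 dl0.
  have E : ((2 `^ kexp d' p l')%:E * ((c / 2 `^ kexp d' p l')%:E * sigma (nonisotropic_ball z dl))
      = c%:E * sigma (nonisotropic_ball z dl))%E.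
    by rewrite muleA -EFinM; congr (_%:E * _)%E; rewrite mulrC mulfVK// lt0r_neq0.
  have ke : (0 < (2 `^ kexp d' p l')%:E :> \bar R)%E by rewrite lte_fin.
  rewrite -(lee_pmul2l _ ke)// E.
  have H := ball_domination hs fmu p0 pl c0 z1 dl0.
  exact: (H hc).
- move=> [c [c0 hc]]; exists c; split => // f cf [hf _].
  apply: (@le_trans _ _ (c%:E *
      \int[sigma]_(z in (@unit_sphere R d'.+1 : set (BorelCd R d'.+1))) ((cabs (f z)) `^ p)%:E)%E).
    by apply: lee_wpmul2l; [rewrite lee_fin ltW|exact: Hp_pow_le].
  have ch := within_cabs_powR p0 cf.
  apply: le_trans (sphere_domination hs fmu c0 hc ch (fun z => powR_ge0 _ _)) _.
  apply: ge0_subset_integral.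
  - exact: sphere_borel.
  - exact: ball_borel.
  - by apply/measurable_EFinP; exact: within_ball_measurable.
  - by move=> z _; rewrite lee_fin powR_ge0.
  - exact: sub_sphere_ball.
Qed.
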